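(* Let $G=(V,E)$ be a connected undirected graph with $V=\{1,\ldots,N\}$ and $M=|E|$. For $i=1,\ldots,N$ let $C_i:\mathbb{R}^n\to\mathbb{R}^{r_i}$ be a linear operator and let $f_i:\mathbb{R}^n\to\mathbb{R}\cup\{\infty\}$, $g_i:\mathbb{R}^{r_i}\to\mathbb{R}\cup\{\infty\}$ be proper closed convex functions. Assume that the set $S^\star$ of minimizers over $x\in\mathbb{R}^n$ of $\sum_{i=1}^N \bigl(f_i(x)+g_i(C_ix)\bigr)$ is nonempty, and that there exist $x_i\in\operatorname{ri}\operatorname{dom}f_i$ with $C_ix_i\in\operatorname{ri}\operatorname{dom}g_i$, $i=1,\ldots,N$, such that $\sum_{i=1}^N A_ix_i=0$. Fix $\theta\in[0,\infty)$ and stepsizes $\sigma_i>0$, $\tau_i>0$ ($i=1,\ldots,N$) and $\kappa_{i,j}=\kappa_{j,i}=\pi_l>0$ for each edge $(i,j)\in E$, where $l\in\{1,\ldots,M\}$ is the index of the edge. Let $\bar\sigma=\max\{\sigma_1,\ldots,\sigma_N\}$, $\bar\tau=\max\{\tau_1,\ldots,\tau_N,\pi_1,\ldots,\pi_M\}$ and $L=\mathcal{L}\otimes I_n+\boldsymbol{C}^\top\boldsymbol{C}$. Suppose that $$\bar\sigma^{-1}-\bar\tau(\theta^2-3\theta+3)\|L\|>0,$$ where in the case $\theta=2$ this strict inequality is replaced by $\bar\sigma^{-1}-\bar\tau\|L\|\ge 0$. Let $x_i^0\in\mathbb{R}^n$, $y_i^0\in\mathbb{R}^{r_i}$, $\rho_i^0\in\mathbb{R}^n$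 ($i=1,\ldots,N$) be initial values, and let the sequences be generated for $k=0,1,2,\ldots$ and all $i=1,\ldots,N$ by $$x_i^{k+1}=\operatorname{prox}_{\sigma_if_i}\bigl(x_i^k-\sigma_i\rho_i^k-\sigma_iC_i^\top y_i^k\bigr),$$ $$\bar y_i^k=\operatorname{prox}_{\tau_ig_i^*}\bigl(y_i^k+\tau_iC_i(\theta x_i^{k+1}+(1-\theta)x_i^k)\bigr),$$ $$y_i^{k+1}=\bar y_i^k+\tau_i(2-\theta)C_i(x_i^{k+1}-x_i^k),$$ $$u_i^k=2x_i^{k+1}-x_i^k,$$ $$\rho_i^{k+1}=\rho_i^k+\sum_{j\in\mathcal{N}_i}\kappa_{i,j}(u_i^k-u_j^k).$$ Then the sequence $(\boldsymbol{x}^k)_{k\in\mathbb{N}}=(x_1^k,\ldots,x_N^k)_{k\in\mathbb{N}}$ converges to $(x^\star,\ldots,x^\star)$ for some $x^\star\in S^\star$.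
   Context: $\mathcal{N}_i=\{j\in V: (i,j)\in E\}$ is the set of neighbors of node $i$. Edges are unordered pairs, indexed bijectively by $l=1,\ldots,M$. Fix any orientation of the edges; $B\in\mathbb{R}^{N\times M}$ is the oriented node-arc incidence matrix: the column associated with edge $(i,j)$ has $+1$ in the $i$-th entry, $-1$ in the $j$-th entry, and zeros elsewhere. $A=B^\top\otimes I_n\in\mathbb{R}^{Mn\times Nn}$, and $A_1,\ldots,A_N\in\mathbb{R}^{Mn\times n}$ are its block columns, so that $A\boldsymbol{x}=\sum_{i=1}^N A_ix_i$ for $\boldsymbol{x}=(x_1,\ldots,x_N)$, and $A\boldsymbol{x}=0$ expresses $x_i=x_j$ for all $(i,j)\in E$. $\mathcal{L}=BB^\top\in\mathbb{R}^{N\times N}$ is the graph Laplacian of $G$ (diagonal entries are the vertex degrees, off-diagonal entries are $-1$ for adjacent nodes and $0$ otherwise). $\boldsymbol{C}=\operatorname{blkdiag}(C_1,\ldots,C_N)$. $\|L\|$ is the operator (spectral) norm. $q^*$ denotes the Fenchel conjugate of $q$; $\operatorname{dom}$ denotes the effective domain and $\operatorname{ri}$ the relative interior. For a proper closed convex function $q$ and $\sigma>0$, $\operatorname{prox}_{\sigma q}(x)=\arg\min_z\{\sigma q(z)+\tfrac12\|x-z\|^2\}$ with the Euclidean norm.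
   Formalization: The initial values ρ_i^0 are required to have the form ρ_i^0 = A_i^T w^0 for some w^0 (for connected G, equivalently Σ_i ρ_i^0 = 0); for arbitrary ρ_i^0 the claim fails, e.g. f_i = g_i = 0, C_i = 0, ρ_i^0 = 1 gives divergent iterates. *)

(* Defs.v *)
From mathcomp Require Import all_boot all_order all_algebra.
From mathcomp Require Import mxtens.
From mathcomp Require Import all_classical all_reals all_analysis.

Set Implicit Arguments.
Unset Strict Implicit.
Unset Printing Implicit Defensive.

Import Order.TTheory GRing.Theory Num.Theory.
Import numFieldNormedType.Exports.

Local Open Scope classical_set_scope.
Local Open Scope ring_scope.

Section Euclidean.
Context {R : realType}.

(* The library norm on matrices is the sup norm, hence an explicit Euclidean
   norm. Both induce the library topology on 'cV[R]_n. *)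
Definition dotv (n : nat) (u v : 'cV[R]_n) : R := (u^T *m v) 0 0.
Definition norm2 (n : nat) (u : 'cV[R]_n) : R := Num.sqrt (dotv u u).

Definition opnorm (m n : nat) (T : 'M[R]_(m, n)) : R :=
  sup [set norm2 (T *m v) | v in [set v : 'cV[R]_n | norm2 v <= 1]].

End Euclidean.

Section ConvexAnalysis.
Context {R : realType}.
Local Open Scope ereal_scope.

Definition minimizers (T : Type) (F : T -> \bar R) : set T :=
  [set x | forall z, F x <= F z].

Section Functions.
Context {n : nat}.
Implicit Types (q : 'cV[R]_n -> \bar R) (S : set 'cV[R]_n).

Definition edom q : set 'cV[R]_n := [set x | q x < +oo].

Definition proper_fun q : Prop :=
  (forall x, q x != -oo) /\ edom q !=set0.

Definition closed_fun q : Prop :=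
  closed [set p : 'cV[R]_n * R | q p.1 <= p.2%:E].

Definition convex_fun q : Prop :=
  forall (x y : 'cV[R]_n) (t : R), (0 < t < 1)%R ->
    q (t *: x + (1 - t) *: y)%R <= t%:E * q x + (1 - t)%:E * q y.

Definition pcc_fun q : Prop := [/\ proper_fun q, closed_fun q & convex_fun q].

Definition conjugate q (y : 'cV[R]_n) : \bar R :=
  ereal_sup [set (dotv x y)%:E - q x | x in [set: 'cV[R]_n]].

Definition affine_hull S : set 'cV[R]_n :=
  [set x | exists (m : nat) (c : 'I_m -> R) (p : 'I_m -> 'cV[R]_n),
    [/\ forall i, S (p i), (\sum_i c i = 1)%R & (x = \sum_i c i *: p i)%R]].

Definition relint S : set 'cV[R]_n :=
  [set x | S x /\ exists2 eps : R, (0 < eps)%R &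
    forall z, affine_hull S z -> (norm2 (z - x) < eps)%R -> S z].

(* [prox s q x] is the argmin set itself; for q proper, closed and convex it is
   a singleton, so membership [p \in prox s q x] reads p = prox_{s q}(x). *)
Definition prox (s : R) q (x : 'cV[R]_n) : set 'cV[R]_n :=
  minimizers (fun z => s%:E * q z + (2^-1 * norm2 (x - z) ^+ 2)%:E).

End Functions.
End ConvexAnalysis.

Section Graph.
Context {N : nat}.

Definition edge_set (e : rel 'I_N) : {set {set 'I_N}} :=
  [set [set p.1; p.2]%SET | p : 'I_N * 'I_N & e p.1 p.2]%SET.

Definition connected_graph (e : rel 'I_N) : Prop :=
  (0 < N)%N /\ forall i j : 'I_N, connect e i j.

(* An oriented bijective indexing of the edges by 'I_M (so that M is the number
   of edges): edge l goes from (ends l).1 to (ends l).2. *)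
Definition edge_indexing (e : rel 'I_N) (M : nat)
    (ends : 'I_M -> 'I_N * 'I_N) : Prop :=
  let edge l := [set (ends l).1; (ends l).2]%SET in
  injective edge /\ [set edge l | l : 'I_M]%SET = edge_set e.

End Graph.

Section BlockMatrices.
Context {R : realType} {N : nat}.

Definition incidence (M : nat) (ends : 'I_M -> 'I_N * 'I_N) : 'M[R]_(N, M) :=
  \matrix_(i, l) ((i == (ends l).1)%:R - (i == (ends l).2)%:R).

Definition laplacian (M : nat) (ends : 'I_M -> 'I_N * 'I_N) : 'M[R]_N :=
  incidence ends *m (incidence ends)^T.

(* The Kronecker product [*t] identifies 'I_(N * n) with 'I_N * 'I_n through
   [mxtens_index]; this is the indexing of R^(Nn) used below. *)
Definition consensus_mx (M n : nat) (ends : 'I_M -> 'I_N * 'I_N) :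
    'M[R]_(M * n, N * n) :=
  (incidence ends)^T *t (1%:M : 'M[R]_n).

Definition block_col (m n : nat) (A : 'M[R]_(m, N * n)) (i : 'I_N) :
    'M[R]_(m, n) :=
  \matrix_(s, a) A s (mxtens_index (i, a)).

Definition stack (n : nat) (x : 'I_N -> 'cV[R]_n) : 'cV[R]_(N * n) :=
  \col_s x (mxtens_unindex s).1 (mxtens_unindex s).2 0.

(* blkdiag (C_1, .., C_N): [tagnat.sig1 s] is the block containing row s and
   [tagnat.sig2 s] the position of s within that block. *)
Definition blkdiag (n : nat) (r : 'I_N -> nat)
    (C : forall i : 'I_N, 'M[R]_(r i, n)) : 'M[R]_(\sum_i r i, N * n) :=
  \matrix_(s, t) (C (tagnat.sig1 s) (tagnat.sig2 s) (mxtens_unindex t).2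
                  *+ (tagnat.sig1 s == (mxtens_unindex t).1)).

Definition Lmx (M n : nat) (ends : 'I_M -> 'I_N * 'I_N) (r : 'I_N -> nat)
    (C : forall i : 'I_N, 'M[R]_(r i, n)) : 'M[R]_(N * n) :=
  laplacian ends *t (1%:M : 'M[R]_n) + (blkdiag C)^T *m blkdiag C.

End BlockMatrices.

(* Main.v *)
Require Import Defs.
From mathcomp Require Import all_boot all_order all_algebra mxtens ring lra.
From mathcomp Require Import all_classical all_reals all_analysis.

Set Implicit Arguments.
Unset Strict Implicit.
Unset Printing Implicit Defensive.

Import Order.TTheory GRing.Theory Num.Theory.
Import numFieldNormedType.Exports.

Local Open Scope classical_set_scope.
Local Open Scope ring_scope.

(** The method is a primal-dual splitting for min f(x) + h(K x), where K stacks
    blkdiag(C_i) on top of the consensus operator A and h is the sum of the g_i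
    and of the indicator of {0} on the edge variables w, with rho = A^T w; then
    L = K^T K.  Adding the two monotonicity inequalities of one step gives
    V(z+) <= V(z) - E for the squared distance V to a saddle point in the metric
    P = [[S^-1 + (2 - theta) K^T T K, - K^T], [- K, T^-1]], where
    E = |dx|^2_{S^-1} - (theta^2 - 3 theta + 3) |K dx|^2_T + |dy - T K dx|^2_{T^-1}
    is nonnegative by the stepsize condition.  Hence the residuals of the
    inclusions vanish, the iterates stay bounded, every limit along an
    ultrafilter is a saddle point, and V to that point tends to 0.  When
    theta = 2 the metric may degenerate, but one more resolvent step is
    controlled by V.

    A saddle point exists because the linear constraints s = C x, A x = 0 can be
    dualised one scalar equation at a time, the relative interior condition
    making each multiplier finite.  Since g_i is only reached through the prox
    of its conjugate, Moreau's decomposition is used to return to the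
    subdifferential of g_i. *)

(** * Limits of vectors and the dot product *)

Section VectorLimits.
Context {R : realType}.

(** A neighbourhood of a matrix contains a product of neighbourhoods of its finitely many
    entries. *)
Lemma cvg_mxP (T : Type) (F : set_system T) (FF : Filter F) (m n : nat)
    (u : T -> 'M[R]_(m, n)) (l : 'M[R]_(m, n)) :
  u k @[k --> F] --> l <-> forall i j, u k i j @[k --> F] --> l i j.
Proof.
split=> [ul i j|ul A [P Pl PA]].
  exact: (cvg_comp _ _ ul (@coord_continuous R m n i j l)).
have H : \forall k \near F, forall ij : 'I_m * 'I_n, P ij.1 ij.2 (u k ij.1 ij.2).
  by apply: filter_forall => -[i j] /=; apply: (ul i j); exact: Pl.
by apply: filterS H => k Pk; apply: PA => i j; exact: (Pk (i, j)).
Qed.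

Lemma cvg_sumr (T : Type) (F : set_system T) (FF : Filter F) (I : Type)
    (s : seq I) (u : I -> T -> R) (l : I -> R) :
  (forall i, u i k @[k --> F] --> l i) ->
  \sum_(i <- s) u i k @[k --> F] --> \sum_(i <- s) l i.
Proof. by move=> ul; apply: cvg_big => //; exact: add_continuous. Qed.

Lemma cvg_mulmx (T : Type) (F : set_system T) (FF : Filter F) (m n : nat)
    (A : 'M[R]_(m, n)) (u : T -> 'cV[R]_n) (l : 'cV[R]_n) :
  u k @[k --> F] --> l -> A *m u k @[k --> F] --> A *m l.
Proof.
move/cvg_mxP => ul; apply/cvg_mxP => i j.
under eq_fun do rewrite mxE.
by rewrite mxE; apply: cvg_sumr => k; apply: cvgM; [exact: cvg_cst|exact: ul].
Qed.

Lemma dotvE (n : nat) (u v : 'cV[R]_n) : dotv u v = \sum_i u i 0 * v i 0.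
Proof. by rewrite /dotv mxE; apply: eq_bigr => i _; rewrite mxE. Qed.

Lemma cvg_dotv (T : Type) (F : set_system T) (FF : Filter F) (n : nat)
    (u v : T -> 'cV[R]_n) (lu lv : 'cV[R]_n) :
  u k @[k --> F] --> lu -> v k @[k --> F] --> lv ->
  dotv (u k) (v k) @[k --> F] --> dotv lu lv.
Proof.
move=> /cvg_mxP ul /cvg_mxP vl; under eq_fun do rewrite dotvE.
by rewrite dotvE; apply: cvg_sumr => i; exact: cvgM.
Qed.

Lemma cvg_sqr0 (T : Type) (F : set_system T) (FF : Filter F) (a b : T -> R) :
  (\forall k \near F, a k ^+ 2 <= b k) ->
  b k @[k --> F] --> 0 -> a k @[k --> F] --> 0.
Proof.
move=> ab b0; apply/norm_cvg0P.
have sb : Num.sqrt (b k) @[k --> F] --> 0.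
  by rewrite -[in X in _ --> X]sqrtr0; apply: (cvg_comp _ _ b0 (@sqrt_continuous R 0)).
apply: squeeze_cvgr (cvg_cst 0) sb.
apply: filterS ab => k abk; rewrite normr_ge0 -sqrtr_sqr.
exact: ler_wsqrtr.
Qed.

(** Replaces the extraction of convergent subsequences. The values lie in a compact segment, hence
    have a cluster point; for an ultrafilter this is a limit, because the preimage of a set or that
    of its complement belongs to [U]. *)
Lemma ultrafilter_cvg (T : Type) (U : set_system T) (UU : UltraFilter U)
    (a : T -> R) (b : R) :
  (\forall k \near U, a k ^+ 2 <= b) -> exists l : R, a k @[k --> U] --> l.
Proof.
move=> ab.
(* As |a| <= a^2 + 1, the bound [b + 1] avoids a square root. *)
have FA : (a @ U) [set` `[(- (b + 1)), (b + 1)]].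
  apply: filterS ab => k abk /=.
  by rewrite in_itv /=; apply/andP; split; nra.
have [l [_ cl]] := segment_compact (fmap_proper_filter a _) FA.
exists l => B nB; have [//|UC] := in_ultra_setVsetC (a @^-1` B) UU.
have [y [/= yB]] := cl (~` B) B UC nB.
by [].
Qed.

Lemma ultrafilter_cvgv (T : Type) (U : set_system T) (UU : UltraFilter U)
    (n : nat) (u : T -> 'cV[R]_n) (b : R) :
  (\forall k \near U, dotv (u k) (u k) <= b) -> exists l : 'cV[R]_n, u k @[k --> U] --> l.
Proof.
move=> ub.
have H i : exists l : R, u k i 0 @[k --> U] --> l.
  apply: (ultrafilter_cvg UU (b := b)); apply: filterS ub => k; apply: le_trans.
  rewrite dotvE (bigD1 i) //= -expr2 lerDl sumr_ge0 // => j _.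
  by rewrite -expr2 sqr_ge0.
have [l Hl] := choice H.
exists (\col_i l i); apply/cvg_mxP => i j; rewrite (ord1 j) mxE; exact: Hl.
Qed.

End VectorLimits.

Section DotProduct.
Context {R : realType}.
Implicit Types n : nat.

Lemma dotvC n (u v : 'cV[R]_n) : dotv u v = dotv v u.
Proof. by rewrite !dotvE; apply: eq_bigr => i _; rewrite mulrC. Qed.

Lemma dotvDl n (u v w : 'cV[R]_n) : dotv (u + v) w = dotv u w + dotv v w.
Proof. by rewrite /dotv linearD mulmxDl mxE. Qed.

Lemma dotvZl n (a : R) (u w : 'cV[R]_n) : dotv (a *: u) w = a * dotv u w.
Proof. by rewrite /dotv linearZ -scalemxAl mxE. Qed.

Lemma dotvNl n (u w : 'cV[R]_n) : dotv (- u) w = - dotv u w.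
Proof. by rewrite -scaleN1r dotvZl mulN1r. Qed.

Lemma dotvBl n (u v w : 'cV[R]_n) : dotv (u - v) w = dotv u w - dotv v w.
Proof. by rewrite dotvDl dotvNl. Qed.

Lemma dotvDr n (u v w : 'cV[R]_n) : dotv w (u + v) = dotv w u + dotv w v.
Proof. by rewrite dotvC dotvDl !(dotvC w). Qed.

Lemma dotvZr n (a : R) (u w : 'cV[R]_n) : dotv w (a *: u) = a * dotv w u.
Proof. by rewrite dotvC dotvZl (dotvC w). Qed.

Lemma dotvNr n (u w : 'cV[R]_n) : dotv w (- u) = - dotv w u.
Proof. by rewrite dotvC dotvNl (dotvC w). Qed.

Lemma dotvBr n (u v w : 'cV[R]_n) : dotv w (u - v) = dotv w u - dotv w v.
Proof. by rewrite dotvDr dotvNr. Qed.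

Lemma dot0v n (u : 'cV[R]_n) : dotv 0 u = 0.
Proof. by rewrite -(scale0r 0) dotvZl mul0r. Qed.

Lemma dotv0 n (u : 'cV[R]_n) : dotv u 0 = 0.
Proof. by rewrite dotvC dot0v. Qed.

Lemma dotv_ge0 n (u : 'cV[R]_n) : 0 <= dotv u u.
Proof. by rewrite dotvE sumr_ge0 // => i _; rewrite -expr2 sqr_ge0. Qed.

Lemma dotv_eq0 n (u : 'cV[R]_n) : dotv u u = 0 -> u = 0.
Proof.
rewrite dotvE => /eqP; rewrite psumr_eq0; last by move=> i _; rewrite -expr2 sqr_ge0.
move=> /allP u0; apply/matrixP => i j; rewrite (ord1 j) mxE.
by have := u0 i (mem_index_enum i); rewrite -expr2 sqrf_eq0 => /eqP.
Qed.

Lemma sqr_norm2 n (u : 'cV[R]_n) : norm2 u ^+ 2 = dotv u u.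
Proof. by rewrite sqr_sqrtr // dotv_ge0. Qed.

Lemma dotv_mulmx m n (A : 'M[R]_(m, n)) (u : 'cV[R]_n) (v : 'cV[R]_m) :
  dotv (A *m u) v = dotv u (A^T *m v).
Proof. by rewrite /dotv trmx_mul mulmxA. Qed.

Lemma dotv_col_mx m n (a c : 'cV[R]_m) (b d : 'cV[R]_n) :
  dotv (col_mx a b) (col_mx c d) = dotv a c + dotv b d.
Proof. by rewrite /dotv tr_col_mx mul_row_col mxE. Qed.

(** Stated for an abstract polynomial because it serves both the dot product and the form [S], which
    is only semidefinite. When c = 0, a nonzero [b] would allow the value -1. *)
Lemma discriminant_le0 (a b c : R) :
  0 <= c -> (forall t : R, 0 <= a - 2 * t * b + t ^+ 2 * c) -> b ^+ 2 <= a * c.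
Proof.
rewrite le_eqVlt => /orP[/eqP <-|c0] H.
  rewrite mulr0; case: (eqVneq b 0) => [->|b0]; first by rewrite expr0n.
  have := H ((a + 1) / (2 * b)); rewrite mulr0 addr0.
  have -> : a - 2 * ((a + 1) / (2 * b)) * b = - 1 by field.
  by rewrite oppr_ge0 ler10.
have := H (b / c).
have -> : a - 2 * (b / c) * b + (b / c) ^+ 2 * c = (a * c - b ^+ 2) / c.
  by field; rewrite gt_eqF.
by rewrite pmulr_lge0 ?invr_gt0 // subr_ge0.
Qed.

Lemma CauchySchwarz_dotv n (u v : 'cV[R]_n) :
  dotv u v ^+ 2 <= dotv u u * dotv v v.
Proof.
apply: discriminant_le0 => [|t]; first exact: dotv_ge0.
have := dotv_ge0 (u - t *: v).
rewrite !(dotvBl, dotvBr, dotvZl, dotvZr) (dotvC v u); nra.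
Qed.

Lemma norm2Z n (a : R) (u : 'cV[R]_n) : norm2 (a *: u) = `|a| * norm2 u.
Proof.
rewrite /norm2 dotvZl dotvZr mulrA -expr2 sqrtrM ?sqr_ge0 //.
by rewrite sqrtr_sqr.
Qed.

End DotProduct.

(** * Subgradients, proximal points and multipliers *)

Section Subgradients.
Context {R : realType} {n : nat}.
Implicit Types (q : 'cV[R]_n -> \bar R) (x p : 'cV[R]_n).

(** Finiteness at [x] is built in, so that subgradient inequalities can be added in the reals. *)
Definition subgrad q x p : Prop :=
  exists2 c : R, q x = c%:E & forall z, ((c + dotv p (z - x))%:E <= q z)%E.

Lemma subgrad_mono q x x' p p' :
  subgrad q x p -> subgrad q x' p' -> 0 <= dotv (p - p') (x - x').
Proof.
move=> [c qx H] [c' qx' H']; have := H x'; have := H' x.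
rewrite qx qx' !lee_fin.
rewrite !(dotvBl, dotvBr, dotvDl); lra.
Qed.

(** For [z] of finite value, the points (u_k, q(z) - <v_k, z - u_k>) lie in the closed epigraph, and
    their limit expresses the subgradient inequality at [lu]. One point of the domain makes [q lu]
    finite. *)
Lemma subgrad_closed (T : Type) (F : set_system T) (FF : ProperFilter F) q
    (u v : T -> 'cV[R]_n) (lu lv : 'cV[R]_n) :
  proper_fun q -> closed_fun q ->
  u k @[k --> F] --> lu -> v k @[k --> F] --> lv ->
  (forall k, subgrad q (u k) (v k)) -> subgrad q lu lv.
Proof.
move=> [qNy [z0 qz0]] qcl ul vl H.
have key (z : 'cV[R]_n) (c : R) : q z = c%:E -> (q lu <= (c - dotv lv (z - lu))%:E)%E.
  move=> qz.
  apply: (@closed_cvg _ _ F _ (fun k => (u k, c - dotv (v k) (z - u k)))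
           [set p : 'cV[R]_n * R | (q p.1 <= p.2%:E)%E] qcl _ (lu, c - dotv lv (z - lu))).
    apply: nearW => k /=; have [d -> /(_ z)] := H k.
    by rewrite qz !lee_fin; lra.
  have tl : c - dotv (v k) (z - u k) @[k --> F] --> c - dotv lv (z - lu).
    apply: cvgB; first exact: cvg_cst.
    by apply: cvg_dotv => //; apply: cvgB => //; exact: cvg_cst.
  exact: (cvg_pair (G := nbhs lu) (H := nbhs (c - dotv lv (z - lu))) ul tl).
have fin z : (q z < +oo)%E -> exists c : R, q z = c%:E.
  by have := qNy z; case: (q z) => [c _ _||] //; exists c.
have [c0 qc0] := fin _ qz0.
have [c qc] : exists c : R, q lu = c%:E.
  by apply: fin; apply: le_lt_trans (key _ _ qc0) (ltry _).
exists c => // z; have := qNy z.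
case E : (q z) => [d||] // _; last by rewrite leey.
by have := key _ _ E; rewrite qc !lee_fin; lra.
Qed.

(* The quadratic term is of second order along the segment from p to z, hence
   drops out as t tends to 0. *)
Lemma prox_subgrad q (s : R) (v p : 'cV[R]_n) :
  0 < s -> proper_fun q -> convex_fun q -> prox s q v p ->
  subgrad q p (s^-1 *: (v - p)).
Proof.
move=> s0 [qNy [z0 qz0]] qcv mp.
have fin z : (q z < +oo)%E -> exists c : R, q z = c%:E.
  by have := qNy z; case: (q z) => [c _ _||] //; exists c.
have [c qc] : exists c : R, q p = c%:E.
  have [c0 qc0] := fin _ qz0; apply: fin.
  have := mp z0; rewrite /= qc0 -EFinM -EFinD.
  case: (q p) (qNy p) => [r _ _||//]; first exact: ltry.
  by rewrite gt0_muley ?lte_fin // addye.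
exists c => // z; have := qNy z.
case E : (q z) => [d||] // _; last by rewrite leey.
rewrite lee_fin dotvZl.
set a := dotv (v - p) (z - p); set b := dotv (z - p) (z - p).
have b0 : 0 <= b by exact: dotv_ge0.
have key t : 0 < t < 1 -> s * c <= s * d - a + 2^-1 * t * b.
  move=> t01; have := mp (t *: z + (1 - t) *: p).
  have := qcv z p t t01; rewrite E qc -!EFinM -EFinD.
  rewrite !sqr_norm2.
  have -> : v - (t *: z + (1 - t) *: p) = (v - p) - t *: (z - p).
    by apply/matrixP => i j; rewrite !mxE; ring.
  rewrite !(dotvBl _ (t *: _)) !(dotvBr _ (t *: _)) !dotvZl !dotvZr.
  rewrite (dotvC (z - p) (v - p)) -/a -/b.
  case: (q _) (qNy (t *: z + (1 - t) *: p)) => [w||] // _.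
  rewrite !lee_fin => h1 h2.
  have [t0 t1] := andP t01.
  have h3 : t * (s * c) <= t * (s * d - a + 2^-1 * t * b) by nra.
  by rewrite ler_pM2l in h3.
suff : s * c <= s * d - a.
  move=> h; rewrite -(ler_pM2l s0) mulrDr mulVKf ?gt_eqF //; lra.
rewrite leNgt; apply/negP => h.
set g := s * c - (s * d - a).
have g0 : 0 < g by rewrite /g; lra.
have hb : 0 < b + g + 1 by lra.
(* For this t in (0, 1) the quadratic term t b / 2 is at most g / 2, whereas [key] makes it at least
   [g]. *)
have := key (g / (b + g + 1)).
rewrite divr_gt0 // ltr_pdivrMr // mul1r.
have -> : g < b + g + 1 by lra.
move=> /(_ isT) h1.
have h2 : g <= 2^-1 * (g / (b + g + 1)) * b by rewrite /g in h1 *; lra.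
have h3 : g / (b + g + 1) * b <= g.
  by rewrite mulrAC ler_pdivrMr //; nra.
nra.
Qed.

(** The subgradient inequality says that [x] attains the supremum defining the conjugate at [p]; the
    term of [x] is then an affine minorant that is exact at [p]. *)
Lemma subgrad_conjugate q x p : subgrad q x p -> subgrad (conjugate q) p x.
Proof.
move=> [c qc H]; exists (dotv x p - c).
  apply/eqP; rewrite eq_le; apply/andP; split.
    apply: ge_ereal_sup => _ [z _ <-].
    have := H z; case: (q z) => [d||] //=; last by rewrite addeNy leNye.
    by rewrite -EFinB !lee_fin dotvBr (dotvC p z) (dotvC p x); lra.
  by apply: ereal_sup_ubound; exists x => //; rewrite qc EFinB.
move=> z; apply: le_ereal_sup_tmp; exists ((dotv x z)%:E - q x)%E; first by exists x.
  by rewrite qc -EFinB lee_fin dotvBr; lra.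
Qed.

(** One subgradient supplies both halves: its base point yields an affine minorant of the conjugate,
    and the subgradient itself is a point of finiteness. *)
Lemma conjugate_proper q x p :
  proper_fun q -> subgrad q x p -> proper_fun (conjugate q).
Proof.
move=> [qNy _] sg; have [c qc _] := sg; have [d qd _] := subgrad_conjugate sg.
split=> [z|]; last by exists p; rewrite /edom /= qd ltry.
rewrite -ltNye; apply: lt_le_trans (ltNyr (dotv x z - c)) _.
by apply: ereal_sup_ubound; exists x => //; rewrite qc EFinB.
Qed.

Lemma conjugate_convex q x p :
  proper_fun q -> subgrad q x p -> convex_fun (conjugate q).
Proof.
move=> qp sg y z t /andP[t0 t1].
have [cNy _] := conjugate_proper qp sg; have [qNy _] := qp.
have := cNy y; have := cNy z.
case Ey : (conjugate q y) => [a||] //; case Ez : (conjugate q z) => [b||] // _ _;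
  rewrite ?gt0_muley ?lte_fin ?subr_gt0 ?addye ?addey ?leey //.
apply: ge_ereal_sup => _ [w _ <-].
have ly : ((dotv w y)%:E - q w <= a%:E)%E by rewrite -Ey; apply: ereal_sup_ubound; exists w.
have lz : ((dotv w z)%:E - q w <= b%:E)%E by rewrite -Ez; apply: ereal_sup_ubound; exists w.
case: (q w) (qNy w) ly lz => [d _|_ _ _|//]; last by rewrite addeNy leNye.
by rewrite -!EFinB -!EFinM -EFinD !lee_fin dotvDr !dotvZr; nra.
Qed.

(** Direct method: the subgradient bounds the objective below by a quadratic, so a minimising
    sequence is bounded and converges along an ultrafilter; closedness of the epigraph makes the
    limit a minimiser. *)
Lemma prox_nonempty q (s : R) (a x0 p0 : 'cV[R]_n) :
  0 < s -> proper_fun q -> closed_fun q -> subgrad q x0 p0 -> prox s q a !=set0.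
Proof.
move=> s0 [qNy _] qcl [c0 qc0 H].
have fin z : (q z < +oo)%E -> exists c : R, q z = c%:E.
  by have := qNy z; case: (q z) => [c _ _||] //; exists c.
pose phi z (c : R) := s * c + 2^-1 * dotv (a - z) (a - z).
pose S := [set phi zc.1 zc.2 | zc in [set zc : 'cV[R]_n * R | q zc.1 = zc.2%:E]].
(* [e] is the minimiser and [K] the minimum of the quadratic minorant s (c0 + <p0, z - x0>) + |a -
   z|^2 / 2. *)
pose e := a - s *: p0.
pose K := s * (c0 + dotv p0 (e - x0)) + s ^+ 2 * dotv p0 p0 / 2.
have low z c : q z = c%:E -> K + 2^-1 * dotv (z - e) (z - e) <= phi z c.
  move=> qz; have := H z; rewrite qz lee_fin /phi => h.
  have {h} : s * (c0 + dotv p0 (z - x0)) <= s * c by rewrite ler_pM2l.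
  have -> : z - x0 = (z - e) + (e - x0) by rewrite subrKA.
  have -> : a - z = s *: p0 - (z - e).
    by apply/matrixP => i j; rewrite !mxE; ring.
  move: (z - e) => d; rewrite !dotvBl !dotvBr !dotvZl !dotvZr dotvDr /K (dotvC d p0).
  move: (dotv p0 _) (dotv p0 d) (dotv d d) (dotv p0 p0) => A B D P.
  lra.
have Slb : has_lbound S.
  exists K => _ [[z c] /= qz <-]; apply: le_trans (low _ _ qz).
  by rewrite lerDl mulr_ge0 // dotv_ge0.
have S0 : S !=set0 by exists (phi x0 c0); exists (x0, c0).
have mseq (k : nat) : exists zc : 'cV[R]_n * R,
    q zc.1 = zc.2%:E /\ phi zc.1 zc.2 < inf S + harmonic k.
  have [_ [zc qz <-] h] := inf_adherent (harmonic_gt0 k) (conj S0 Slb).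
  by exists zc.
have [zc Hzc] := choice mseq.
have [U [UU Uoo]] := @ultraFilterLemma nat \oo _.
have [l zl] : exists l : 'cV[R]_n, (zc k).1 - e @[k --> U] --> l.
  apply: (ultrafilter_cvgv UU (b := 2 * (inf S + 1 - K))).
  apply: nearW => k; have [qz h] := Hzc k.
  have := low _ _ qz.
  have : @harmonic R k <= 1 by rewrite /= invf_le1 // ler1n.
  lra.
have {}zl : (zc k).1 @[k --> U] --> l + e.
  under eq_fun do rewrite -[(zc _).1](subrK e).
  by apply: cvgD => //; exact: cvg_cst.
have hl : harmonic k @[k --> U] --> (0 : R).
  exact: cvg_trans (cvg_app _ Uoo) cvg_harmonic.
set zb := l + e in zl *.
(* Solving the bound on [phi] for the value of [q] gives epigraph points whose heights converge. *)
have key : (q zb <= (s^-1 * (inf S + 0 - 2^-1 * dotv (a - zb) (a - zb)))%:E)%E.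
  pose t k := s^-1 * (inf S + harmonic k - 2^-1 * dotv (a - (zc k).1) (a - (zc k).1)).
  set tb := s^-1 * _.
  have tl : t k @[k --> U] --> tb.
    apply: cvgM; first exact: cvg_cst.
    apply: cvgB; first by apply: cvgD => //; exact: cvg_cst.
    apply: cvgM; first exact: cvg_cst.
    by apply: cvg_dotv; apply: cvgB => //; exact: cvg_cst.
  apply: (@closed_cvg _ _ U _ (fun k => ((zc k).1, t k))
           [set p : 'cV[R]_n * R | (q p.1 <= p.2%:E)%E] qcl _ (zb, tb)); last first.
    exact: (cvg_pair (G := nbhs zb) (H := nbhs tb) zl tl).
  apply: nearW => k /=; have [-> h] := Hzc k.
  rewrite lee_fin /t ler_pdivlMl //; move: h; rewrite /phi; lra.
rewrite addr0 in key.
have [c qc] : exists c : R, q zb = c%:E.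
  by apply: fin; apply: le_lt_trans key (ltry _).
rewrite qc lee_fin ler_pdivlMl // in key.
exists zb => z /=; rewrite qc -EFinM -EFinD !sqr_norm2.
have := qNy z; case E : (q z) => [d||] // _; last first.
  by rewrite gt0_muley ?lte_fin // addye // leey.
rewrite -EFinM -EFinD lee_fin.
have : inf S <= phi z d by apply: ge_inf => //; exists (z, d).
by rewrite /phi; lra.
Qed.

(* Moreau's decomposition. *)
Lemma prox_conjugate_subgrad q (s : R) (v p x0 p0 : 'cV[R]_n) :
  0 < s -> pcc_fun q -> subgrad q x0 p0 -> prox s (conjugate q) v p ->
  subgrad q (s^-1 *: (v - p)) p.
Proof.
move=> s0 [qp qcl qcv] sg mp.
have s0' : 0 < s^-1 by rewrite invr_gt0.
have h1 := prox_subgrad s0 (conjugate_proper qp sg) (conjugate_convex qp sg) mp.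
have [w mw] := prox_nonempty (s^-1 *: v) s0' qp qcl sg.
have sw := prox_subgrad s0' qp qcv mw.
rewrite invrK scalerBr scalerA divff ?gt_eqF // scale1r in sw.
(* [w] is a subgradient of the conjugate at v - s w; monotonicity against the subgradient at [p]
   forces p = v - s w. *)
have := subgrad_mono h1 (subgrad_conjugate sw).
have -> : s^-1 *: (v - p) - w = - s^-1 *: (p - (v - s *: w)).
  by apply/matrixP => i j; rewrite !mxE; field; rewrite gt_eqF.
set d := p - _; rewrite dotvZl mulNr oppr_ge0 pmulr_rle0 // => d0.
have /dotv_eq0 /eqP : dotv d d = 0 by apply/eqP; rewrite eq_le d0 dotv_ge0.
rewrite subr_eq0 => /eqP ->.
rewrite opprB addrC subrK scalerA mulVf ?gt_eqF // scale1r.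
exact: sw.
Qed.

(** The segment from [p] to [z] is prolonged beyond [z]: the new point is the affine combination
    with weights 1 + e and - e, at distance e |p - z| from [z]. *)
Lemma relint_edom_extend q (z p : 'cV[R]_n) :
  relint (edom q) z -> edom q p ->
  \forall e \near 0^'+, edom q (z - e *: (p - z)).
Proof.
move=> [qz [d d0 H]] qp.
have nn : 0 <= norm2 (p - z) by exact: sqrtr_ge0.
(* Adding 1 covers the case p = z in the division below. *)
have hp : 0 < norm2 (p - z) + 1 by lra.
near=> e.
have e0 : 0 < e by near: e; exact: nbhs_right_gt.
have ed : e < d / (norm2 (p - z) + 1) by near: e; apply: nbhs_right_lt; rewrite divr_gt0.
apply: H.
  exists 2%N, (fun i : 'I_2 => if i == 0 then 1 + e else - e),
    (fun i : 'I_2 => if i == 0 then z else p); split.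
  - by move=> i; case: ifP.
  - by rewrite big_ord_recl big_ord1 /=; ring.
  - rewrite big_ord_recl big_ord1 /=.
    by apply/matrixP => i j; rewrite !mxE; ring.
have -> : z - e *: (p - z) - z = (- e) *: (p - z).
  by apply/matrixP => i j; rewrite !mxE; ring.
rewrite norm2Z normrN gtr0_norm //.
rewrite ltr_pdivlMr // in ed; nra.
Unshelve. all: by end_near. Qed.

Lemma edom_fine q x : pcc_fun q -> edom q x -> q x = (fine (q x))%:E.
Proof.
move=> [[qNy _] _ _] qx; rewrite fineK // fin_numE qNy /=.
by rewrite lt_eqF.
Qed.

Lemma edom_convex q x y (t : R) : pcc_fun q -> edom q x -> edom q y ->
  0 < t < 1 -> edom q (t *: x + (1 - t) *: y) /\
  fine (q (t *: x + (1 - t) *: y)) <= t * fine (q x) + (1 - t) * fine (q y).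
Proof.
move=> qp qx qy t01; have [_ _ /(_ x y t t01)] := qp.
rewrite (edom_fine qp qx) (edom_fine qp qy) -!EFinM -EFinD => h.
have d : edom q (t *: x + (1 - t) *: y) by exact: le_lt_trans h (ltry _).
by split=> //; rewrite (edom_fine qp d) lee_fin in h.
Qed.

End Subgradients.

Section Multipliers.
Context {R : realType} {X : Type} {J : eqType}.
Variables (b : J -> X -> R) (D : X -> Prop).

(** Abstract form of the qualification: moving from [p] past a feasible relative interior point
    reverses all constraint values up to a positive factor. *)
Hypothesis b_strict : forall p, D p -> exists (e : R) p',
  [/\ 0 < e, D p' & forall j, b j p' = - e * b j p].

(* The constraints are dualised one at a time: the multiplier c of the first
   one is the supremum of the slopes imposed by the points where it is
   negative. *)
Lemma lagrange_multipliers (s : seq J) (phi : X -> R) (mu : R) :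
  uniq s ->
  (forall x y (t : R), D x -> D y -> 0 < t < 1 -> exists z,
    [/\ D z, phi z <= t * phi x + (1 - t) * phi y &
        forall j, b j z = t * b j x + (1 - t) * b j y]) ->
  (forall x, D x -> (forall j, j \in s -> b j x = 0) -> mu <= phi x) ->
  exists c : J -> R, forall x, D x -> mu + \sum_(j <- s) c j * b j x <= phi x.
Proof.
elim: s phi => [|j0 s IH] phi.
  by move=> _ _ H; exists (fun=> 0) => x Dx; rewrite big_nil addr0; exact: H.
move=> /= /andP[j0s us] cvx H.
(* The convex combination of [x] and [y] that cancels constraint [j0] is feasible; hence slopes from
   the negative side lie below those from the positive side. *)
have Hpos x y : D x -> D y -> (forall j, j \in s -> b j x = 0) ->
    (forall j, j \in s -> b j y = 0) -> b j0 x < 0 -> 0 < b j0 y ->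
    (mu - phi x) / (- b j0 x) <= (phi y - mu) / b j0 y.
  move=> Dx Dy sx sy x0 y0.
  set u := - b j0 x; have u0 : 0 < u by rewrite oppr_gt0.
  set v := b j0 y in y0 *.
  have uv : 0 < u + v by rewrite addr_gt0.
  have [|z [Dz hz bz]] := cvx x y (v / (u + v)) Dx Dy.
    by rewrite divr_gt0 //= ltr_pdivrMr // mul1r ltrDr.
  have zE : 1 - v / (u + v) = u / (u + v) by field; rewrite gt_eqF.
  have : mu <= phi z.
    apply: H => // j; rewrite inE => /orP[/eqP ->|js].
      by rewrite bz zE -/v -[b j0 x]opprK -/u; field; rewrite gt_eqF.
    by rewrite bz sx // sy // !mulr0 addr0.
  move=> /le_trans /(_ hz); rewrite zE => h.
  rewrite ler_pdivrMr // mulrAC ler_pdivlMr //.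
  have : mu * (u + v) <= (v / (u + v) * phi x + u / (u + v) * phi y) * (u + v).
    by rewrite ler_pM2r.
  have -> : (v / (u + v) * phi x + u / (u + v) * phi y) * (u + v) =
            v * phi x + u * phi y by field; rewrite gt_eqF.
  lra.
have [c0 Hc0] : exists c0, forall x, D x -> (forall j, j \in s -> b j x = 0) ->
    mu <= phi x - c0 * b j0 x.
  pose S := [set (mu - phi x) / (- b j0 x) | x in
    [set x | [/\ D x, forall j, j \in s -> b j x = 0 & b j0 x < 0]]].
  (* If some point satisfying the other constraints has a negative value, [b_strict] provides one
     with a positive value, which bounds the slopes. Otherwise [b_strict] excludes positive values
     too, and 0 serves as multiplier. *)
  have [S0|/set0P/negP/negPn/eqP S0] := pselect (S !=set0).
    exists (sup S) => x Dx sx.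
    have [_ [xm [Dm sm m0] _]] := S0.
    have [e [xp [e0 Dp bp]]] := b_strict Dm.
    have Sub : has_ubound S.
      exists ((phi xp - mu) / b j0 xp) => _ [y [Dy sy y0] <-].
      apply: Hpos => //; last by rewrite bp; nra.
      by move=> j js; rewrite bp sm // mulr0.
    have [x0|x0|x0] := ltgtP (b j0 x) 0.
    - have : (mu - phi x) / (- b j0 x) <= sup S by apply: ub_le_sup => //; exists x.
      by rewrite ler_pdivrMr ?oppr_gt0 //; lra.
    - have : sup S <= (phi x - mu) / b j0 x.
        by apply: ge_sup => // _ [y [Dy sy y0] <-]; exact: Hpos.
      by rewrite ler_pdivlMr //; lra.
    - rewrite x0 mulr0 subr0; apply: H => // j; rewrite inE => /orP[/eqP -> //|].
      exact: sx.
  have noneg x : D x -> (forall j, j \in s -> b j x = 0) -> 0 <= b j0 x.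
    move=> Dx sx; rewrite leNgt; apply/negP => x0.
    have : S ((mu - phi x) / (- b j0 x)) by exists x.
    by rewrite S0.
  exists 0 => x Dx sx; rewrite mul0r subr0; apply: H => // j.
  rewrite inE => /orP[/eqP ->|]; last exact: sx.
  apply/eqP; rewrite eq_le noneg // andbT leNgt; apply/negP => x0.
  have [e [x' [e0 Dx' bx']]] := b_strict Dx.
  have : 0 <= b j0 x' by apply: noneg => // j' js; rewrite bx' sx // mulr0.
  by rewrite bx'; nra.
have [|c Hc] := IH (fun x => phi x - c0 * b j0 x) us _ Hc0.
  move=> x y t Dx Dy t01; have [z [Dz hz bz]] := cvx x y t Dx Dy t01.
  by exists z; split => //; rewrite bz; lra.
exists (fun j => if j == j0 then c0 else c j) => x Dx.
rewrite big_cons eqxx.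
have -> : \sum_(j <- s) (if j == j0 then c0 else c j) * b j x =
          \sum_(j <- s) c j * b j x.
  rewrite !big_seq; apply: eq_bigr => j js.
  by case: eqP => // jj; rewrite -jj js in j0s.
by have := Hc x Dx; lra.
Qed.

End Multipliers.

(** * Convergence of the primal-dual iteration *)

Section Weights.
Context {R : realType}.
Implicit Types k : nat.

Definition wsc k (w : 'I_k -> R) (u : 'cV[R]_k) : 'cV[R]_k := \col_i (w i * u i 0).

Definition wdot k (w : 'I_k -> R) (u v : 'cV[R]_k) : R := dotv (wsc w u) v.

Lemma wdotE k (w : 'I_k -> R) u v : wdot w u v = \sum_i w i * u i 0 * v i 0.
Proof. by rewrite /wdot dotvE; apply: eq_bigr => i _; rewrite mxE. Qed.

Lemma wscD k (w : 'I_k -> R) u v : wsc w (u + v) = wsc w u + wsc w v.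
Proof. by apply/matrixP => i j; rewrite !mxE; ring. Qed.

Lemma wscZ k (w : 'I_k -> R) a u : wsc w (a *: u) = a *: wsc w u.
Proof. by apply/matrixP => i j; rewrite !mxE; ring. Qed.

Lemma wscB k (w : 'I_k -> R) u v : wsc w (u - v) = wsc w u - wsc w v.
Proof. by apply/matrixP => i j; rewrite !mxE; ring. Qed.

Lemma wdotC k (w : 'I_k -> R) u v : wdot w u v = wdot w v u.
Proof. by rewrite !wdotE; apply: eq_bigr => i _; ring. Qed.

Lemma wdot_ge0 k (w : 'I_k -> R) u : (forall i, 0 < w i) -> 0 <= wdot w u u.
Proof.
move=> w0; rewrite wdotE sumr_ge0 // => i _; rewrite -mulrA -expr2.
by rewrite mulr_ge0 ?sqr_ge0 ?ltW.
Qed.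

Lemma wdot_coercive k (w : 'I_k -> R) : (forall i, 0 < w i) ->
  exists2 G : R, 0 <= G & forall u, dotv u u <= G * wdot w u u.
Proof.
move=> w0; have iw i : 0 <= (w i)^-1 by rewrite invr_ge0 ltW.
(* The sum of the inverse weights dominates each of them. *)
exists (\sum_i (w i)^-1) => [|u]; first by apply: sumr_ge0.
rewrite dotvE wdotE mulr_sumr; apply: ler_sum => i _.
have {1}-> : u i 0 * u i 0 = (w i)^-1 * (w i * u i 0 * u i 0).
  by field; rewrite gt_eqF.
apply: ler_wpM2r; first by rewrite -mulrA -expr2 mulr_ge0 ?sqr_ge0 ?ltW.
by rewrite (bigD1 i) //= lerDl sumr_ge0.
Qed.

Lemma cvg_wsc (T : Type) (F : set_system T) (FF : Filter F) k (w : 'I_k -> R)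
    (u : T -> 'cV[R]_k) (l : 'cV[R]_k) :
  u t @[t --> F] --> l -> wsc w (u t) @[t --> F] --> wsc w l.
Proof.
move/cvg_mxP => ul; apply/cvg_mxP => i j.
under eq_fun do rewrite mxE.
by rewrite mxE; apply: cvgM; [exact: cvg_cst|exact: ul].
Qed.

(** Cauchy-Schwarz on each row; the constant is the squared Frobenius norm. *)
Lemma mulmx_bounded k l (A : 'M[R]_(k, l)) : exists2 G : R, 0 <= G &
  forall u, dotv (A *m u) (A *m u) <= G * dotv u u.
Proof.
exists (\sum_i dotv (row i A)^T (row i A)^T) => [|u].
  by apply: sumr_ge0 => i _; exact: dotv_ge0.
rewrite [leLHS]dotvE mulr_suml; apply: ler_sum => i _.
have -> : (A *m u) i 0 = dotv (row i A)^T u.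
  by rewrite dotvE mxE; apply: eq_bigr => j _; rewrite !mxE.
by rewrite -expr2; exact: CauchySchwarz_dotv.
Qed.

Lemma wsc_bounded k (w : 'I_k -> R) : exists2 G : R, 0 <= G &
  forall u, dotv (wsc w u) (wsc w u) <= G * dotv u u.
Proof.
exists (\sum_i w i ^+ 2) => [|u]; first by apply: sumr_ge0 => i _; exact: sqr_ge0.
rewrite !dotvE mulr_sumr; apply: ler_sum => i _; rewrite mxE.
have -> : w i * u i 0 * (w i * u i 0) = w i ^+ 2 * (u i 0 * u i 0) by ring.
apply: ler_wpM2r; first by rewrite -expr2 sqr_ge0.
by rewrite (bigD1 i) //= lerDl sumr_ge0 // => j _; exact: sqr_ge0.
Qed.

Lemma dotvD_le k (u v : 'cV[R]_k) :
  dotv (u + v) (u + v) <= 2 * dotv u u + 2 * dotv v v.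
Proof.
have := dotv_ge0 (u - v); rewrite !(dotvBl, dotvBr, dotvDl, dotvDr).
by rewrite (dotvC v u); lra.
Qed.

Lemma cvg_dotv0 (T : Type) (F : set_system T) (FF : Filter F) k
    (u : T -> 'cV[R]_k) (b : T -> R) :
  (\forall t \near F, dotv (u t) (u t) <= b t) -> b t @[t --> F] --> 0 ->
  u t @[t --> F] --> (0 : 'cV[R]_k).
Proof.
move=> ub b0; apply/cvg_mxP => i j; rewrite mxE (ord1 j).
apply: cvg_sqr0 b0; apply: filterS ub => t; apply: le_trans.
rewrite dotvE (bigD1 i) //= -expr2 lerDl sumr_ge0 // => l _.
by rewrite -expr2 sqr_ge0.
Qed.

End Weights.

(** * The abstract splitting for two monotone inclusions *)

Section PrimalDual.
Context {R : realType} {m d : nat}.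
Variables (K : 'M[R]_(d, m)) (sigma : 'I_m -> R) (tau : 'I_d -> R) (theta eta : R).
Hypothesis sigma_gt0 : forall i, 0 < sigma i.
Hypothesis tau_gt0 : forall i, 0 < tau i.

Let si i := (sigma i)^-1.
Let ti i := (tau i)^-1.
Let c := theta ^+ 2 - 3 * theta + 3.

(** [eta] is the slack of the stepsize condition. It may vanish at theta = 2, where c = 1 and [step]
    then says that S^-1 - K^T T K is positive semidefinite. *)
Hypothesis eta_ge0 : 0 <= eta.
Hypothesis eta_gt0 : theta != 2 -> 0 < eta.
Hypothesis step : forall v,
  eta * dotv v v + c * wdot tau (K *m v) (K *m v) <= wdot si v v.

Let si_gt0 i : 0 < si i. Proof. by rewrite invr_gt0. Qed.
Let ti_gt0 i : 0 < ti i. Proof. by rewrite invr_gt0. Qed.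

(* The squared distance of Latafat and Patrinos' metric
   [[S^-1 + (2 - theta) K^T T K, - K^T], [- K, T^-1]], with the square
   completed in the dual variable. *)
Definition lyap (X : 'cV[R]_m) (Y : 'cV[R]_d) : R :=
  wdot si X X + (1 - theta) * wdot tau (K *m X) (K *m X)
  + wdot ti (Y - wsc tau (K *m X)) (Y - wsc tau (K *m X)).

Definition decr (dx : 'cV[R]_m) (dy : 'cV[R]_d) : R :=
  wdot si dx dx - c * wdot tau (K *m dx) (K *m dx)
  + wdot ti (dy - wsc tau (K *m dx)) (dy - wsc tau (K *m dx)).

(** [X] and [b] are the errors of the new primal point and of the intermediate dual point, [dx] and
    [dy] the differences from these back to the old ones. The two sides differ by exactly twice the
    sum of the two monotonicity products. *)
Lemma lyap_descent (X dx : 'cV[R]_m) (b dy : 'cV[R]_d) :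
  0 <= dotv (wsc si dx - K^T *m (b + dy)) X ->
  0 <= dotv (wsc ti dy + K *m X + (1 - theta) *: (K *m dx)) b ->
  lyap X (b - (2 - theta) *: wsc tau (K *m dx)) + decr dx dy
    <= lyap (X + dx) (b + dy).
Proof.
rewrite dotvBl dotv_mulmx trmxK.
rewrite /lyap /decr mulmxDr => h1 h2.
have h : 0 <= 2 * (wdot si dx X - dotv (b + dy) (K *m X)
   + dotv (wsc ti dy + K *m X + (1 - theta) *: (K *m dx)) b).
  by rewrite mulr_ge0 // addr_ge0.
rewrite -subr_ge0; apply: le_trans h _; rewrite le_eqVlt; apply/orP; left; apply/eqP.
have e1 : wdot si (X + dx) (X + dx) = wdot si X X + wdot si dx dx + 2 * wdot si dx X.
  by rewrite /wdot wscD !dotvDl !dotvDr -!/(wdot _ _ _) (wdotC si X dx); ring.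
rewrite e1; move: (K *m X) (K *m dx) => a k.
have e2 : 2 * (dotv (wsc ti dy + a + (1 - theta) *: k) b - dotv (b + dy) a) =
   (1 - theta) * wdot tau (a + k) (a + k) - (1 - theta) * wdot tau a a
   + c * wdot tau k k
   + wdot ti (b + dy - wsc tau (a + k)) (b + dy - wsc tau (a + k))
   - wdot ti (b - (2 - theta) *: wsc tau k - wsc tau a)
             (b - (2 - theta) *: wsc tau k - wsc tau a)
   - wdot ti (dy - wsc tau k) (dy - wsc tau k).
  rewrite !wdotE !dotvE !mulr_sumr -!sumrN -!big_split /= mulr_sumr.
  apply: eq_bigr => i _; rewrite !mxE /c /ti.
  by field; rewrite gt_eqF.
lra.
Qed.

Lemma decr_ge dx dy :
  eta * dotv dx dx
  + wdot ti (dy - wsc tau (K *m dx)) (dy - wsc tau (K *m dx)) <= decr dx dy.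
Proof. by rewrite /decr; have := step dx; lra. Qed.

Lemma lyap_ge X Y :
  eta * dotv X X
  + wdot ti (Y - wsc tau (K *m X)) (Y - wsc tau (K *m X)) <= lyap X Y.
Proof.
rewrite /lyap; have := step X.
(* The coefficient left on |K X|^2 is c + 1 - theta = (theta - 2)^2. *)
have : 0 <= (theta - 2) ^+ 2 * wdot tau (K *m X) (K *m X).
  by rewrite mulr_ge0 ?sqr_ge0 // wdot_ge0.
rewrite /c; lra.
Qed.

Lemma lyap_ge0 X Y : 0 <= lyap X Y.
Proof.
apply: le_trans (lyap_ge X Y).
by rewrite addr_ge0 ?wdot_ge0 // mulr_ge0 // dotv_ge0.
Qed.

Lemma decr_ge0 dx dy : 0 <= decr dx dy.
Proof.
apply: le_trans (decr_ge dx dy).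
by rewrite addr_ge0 ?wdot_ge0 // mulr_ge0 // dotv_ge0.
Qed.

(** The form of S^-1 - K^T T K, which is the [X] part of [lyap] at theta = 2. *)
Let S u v := wdot si u v - wdot tau (K *m u) (K *m v).

Let S_ge0 u : theta = 2 -> 0 <= S u u.
Proof.
move=> t2; have := step u; have := mulr_ge0 eta_ge0 (dotv_ge0 u).
by rewrite /S /c t2; lra.
Qed.

Let S_sub (t : R) u v : S (u - t *: v) (u - t *: v) = S u u - 2 * t * S u v + t ^+ 2 * S v v.
Proof.
rewrite /S /wdot !mulmxBr -!scalemxAr !wscB !wscZ !(dotvBl, dotvBr, dotvZl, dotvZr).
rewrite -!/(wdot _ _ _) (wdotC si v u) (wdotC tau (K *m v) (K *m u)); ring.
Qed.

(* At theta = 2 the Lyapunov function may be degenerate; resolving the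
   monotone inclusions still bounds the next iterate. *)
Lemma resolvent_bound2 (X dx : 'cV[R]_m) (b dy : 'cV[R]_d) : theta = 2 ->
  0 <= dotv (wsc si dx - K^T *m (b + dy)) X ->
  0 <= dotv (wsc ti dy + K *m X + (1 - theta) *: (K *m dx)) b ->
  wdot si X X <= 2 * lyap (X + dx) (b + dy) /\
  wdot ti b b <= 18 * lyap (X + dx) (b + dy).
Proof.
move=> t2; set Z := X + dx; set Y := b + dy.
have -> : dx = Z - X by rewrite /Z addrAC subrr add0r.
have -> : dy = Y - b by rewrite /Y addrAC subrr add0r.
rewrite dotvBl dotv_mulmx trmxK.
set q := Y - wsc tau (K *m Z).
have lE : lyap Z Y = S Z Z + wdot ti q q by rewrite /lyap /S -/q t2; ring.
have YE : Y = q + wsc tau (K *m Z) by rewrite /q subrK.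
rewrite lE YE => h1 h2.
have k0 := wdot_ge0 (K *m X) tau_gt0.
have q0 := wdot_ge0 q ti_gt0.
have sX : wdot tau (K *m X) (K *m X) <= wdot si X X.
  by have := S_ge0 X t2; rewrite /S; lra.
(* The first inclusion gives |X|^2 <= S(Z, X) - <q, K X>. Young's inequality on both terms leaves a
   quarter of S(X, X) + |K X|^2 = |X|^2, which is absorbed; the resulting factor 4/3 is rounded up
   to 2. *)
have g1 : wdot si X X <= 2 * (S Z Z + wdot ti q q).
  have := S_ge0 (Z - 2^-1 *: X) t2; rewrite S_sub.
  have : 0 <= \sum_i ti i * (q i 0 + 2^-1 * tau i * (K *m X) i 0) ^+ 2.
    by apply: sumr_ge0 => i _; rewrite mulr_ge0 ?sqr_ge0 // ltW.
  have -> : \sum_i ti i * (q i 0 + 2^-1 * tau i * (K *m X) i 0) ^+ 2 =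
    wdot ti q q + dotv q (K *m X) + 2^-1 ^+ 2 * wdot tau (K *m X) (K *m X).
    rewrite !wdotE dotvE mulr_sumr -!big_split /=; apply: eq_bigr => i _.
    by rewrite /ti; field; rewrite gt_eqF.
  move: h1; rewrite wscB dotvBl dotvDl -!/(wdot _ _ _).
  move: sX k0; rewrite /S; lra.
split=> //.
(* Young again: |b|^2 / 2 <= |q|^2 + 4 |K X|^2, which is at most 1 + 4 * 2 Lyapunov values; hence
   18. *)
have : 0 <= \sum_i ti i * (q i 0 - 2^-1 * b i 0) ^+ 2.
  by apply: sumr_ge0 => i _; rewrite mulr_ge0 ?sqr_ge0 // ltW.
have -> : \sum_i ti i * (q i 0 - 2^-1 * b i 0) ^+ 2 =
    wdot ti q q - wdot ti q b + 2^-1 ^+ 2 * wdot ti b b.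
  by rewrite !wdotE mulr_sumr -!sumrN -!big_split /=; apply: eq_bigr => i _; field.
have : 0 <= \sum_i ti i * (2 * (tau i * (K *m X) i 0) - 2^-1 * b i 0) ^+ 2.
  by apply: sumr_ge0 => i _; rewrite mulr_ge0 ?sqr_ge0 // ltW.
have -> : \sum_i ti i * (2 * (tau i * (K *m X) i 0) - 2^-1 * b i 0) ^+ 2 =
    4 * wdot tau (K *m X) (K *m X) - 2 * dotv (K *m X) b + 2^-1 ^+ 2 * wdot ti b b.
  rewrite !wdotE dotvE !mulr_sumr -!sumrN -!big_split /=; apply: eq_bigr => i _.
  by rewrite /ti; field; rewrite gt_eqF.
have e3 : dotv (wsc ti (q + wsc tau (K *m Z) - b) + K *m X + (1 - theta) *: (K *m (Z - X))) b
  = wdot ti q b - wdot ti b b + 2 * dotv (K *m X) b.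
  rewrite mulmxBr t2 !wdotE !dotvE mulr_sumr -!sumrN -!big_split /=; apply: eq_bigr => i _.
  move: (K *m Z) (K *m X) => a k; rewrite !mxE /ti; field; rewrite gt_eqF //.
move: h2; rewrite e3; have := S_ge0 Z t2; lra.
Qed.

(** The positive slack controls [X], the completed square controls Y - T K X, and together they
    control [Y]. *)
Lemma lyap_coercive : theta != 2 -> exists2 G : R, 0 <= G &
  forall X Y, dotv X X + dotv Y Y <= G * lyap X Y.
Proof.
move=> /eta_gt0 e0.
have [G1 G10 H1] := wdot_coercive ti_gt0.
have [G2 G20 H2] := wsc_bounded tau.
have [G3 G30 H3] := mulmx_bounded K.
exists ((1 + 2 * G2 * G3) / eta + 2 * G1).
  by rewrite addr_ge0 ?mulr_ge0 ?invr_ge0 ?(ltW e0) // addr_ge0 ?mulr_ge0.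
move=> X Y; set V := lyap X Y.
have := lyap_ge X Y; set q := Y - _; rewrite -/V => hV.
have q0 := wdot_ge0 q ti_gt0.
have X0 := dotv_ge0 X.
have hX : dotv X X <= V / eta by rewrite ler_pdivlMr // mulrC; lra.
have hq : dotv q q <= G1 * V.
  apply: le_trans (H1 q) _; apply: ler_wpM2l => //.
  by have := mulr_ge0 eta_ge0 X0; lra.
have hY : dotv Y Y <= 2 * (G1 * V) + 2 * (G2 * (G3 * (V / eta))).
  have -> : Y = q + wsc tau (K *m X) by rewrite subrK.
  apply: le_trans (dotvD_le _ _) _.
  apply: lerD; apply: ler_wpM2l => //.
  apply: le_trans (H2 _) _; apply: ler_wpM2l => //.
  by apply: le_trans (H3 _) _; apply: ler_wpM2l.
rewrite mulrDl mulrAC mulrDl mul1r mulrDl.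
have -> : 2 * G2 * G3 * V / eta = 2 * (G2 * (G3 * (V / eta))) by ring.
lra.
Qed.

(** These stand for the graphs of the subdifferentials of f and h. As [B] relates a point to its
    dual variables, [y_incl] is the resolvent step on the conjugate of h after Moreau's
    decomposition. *)
Variables (A : 'cV[R]_m -> 'cV[R]_m -> Prop) (B : 'cV[R]_d -> 'cV[R]_d -> Prop).
Hypothesis A_mono : forall u u' p p', A u p -> A u' p' -> 0 <= dotv (p - p') (u - u').
Hypothesis B_mono : forall u u' p p', B u p -> B u' p' -> 0 <= dotv (u - u') (p - p').
Hypothesis A_closed : forall (F : set_system nat), ProperFilter F ->
  forall (u p : nat -> 'cV[R]_m) (lu lp : 'cV[R]_m),
  u k @[k --> F] --> lu -> p k @[k --> F] --> lp ->
  (forall k, A (u k) (p k)) -> A lu lp.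
Hypothesis B_closed : forall (F : set_system nat), ProperFilter F ->
  forall (u p : nat -> 'cV[R]_d) (lu lp : 'cV[R]_d),
  u k @[k --> F] --> lu -> p k @[k --> F] --> lp ->
  (forall k, B (u k) (p k)) -> B lu lp.

Definition saddle (u : 'cV[R]_m) (v : 'cV[R]_d) : Prop :=
  A u (- (K^T *m v)) /\ B (K *m u) v.

Variables (x : nat -> 'cV[R]_m) (y yb : nat -> 'cV[R]_d).
Hypothesis x_incl : forall k,
  A (x k.+1) (wsc si (x k - x k.+1) - K^T *m y k).
Hypothesis y_incl : forall k,
  B (wsc ti (y k - yb k) + K *m (theta *: x k.+1 + (1 - theta) *: x k)) (yb k).
Hypothesis y_upd : forall k,
  y k.+1 = yb k + (2 - theta) *: wsc tau (K *m (x k.+1 - x k)).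

Let dx k := x k - x k.+1.
Let dy k := y k - yb k.

Section Fejer.
Variables (xs : 'cV[R]_m) (ys : 'cV[R]_d).
Hypothesis sad : saddle xs ys.

Let V k := lyap (x k - xs) (y k - ys).

Let mono_x k :
  0 <= dotv (wsc si (dx k) - K^T *m (yb k - ys + dy k)) (x k.+1 - xs).
Proof.
have := A_mono (x_incl k) sad.1; congr (0 <= dotv _ _).
rewrite -/(dx k) opprK -addrA -[in LHS]mulNmx; congr (_ + _).
rewrite mulNmx -mulmxN -mulmxDr -mulmxN; congr (_ *m _).
by rewrite /dy; apply/matrixP => i j; rewrite !mxE; ring.
Qed.

Let mono_y k :
  0 <= dotv (wsc ti (dy k) + K *m (x k.+1 - xs) + (1 - theta) *: (K *m dx k)) (yb k - ys).
Proof.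
have := B_mono (y_incl k) sad.2; congr (0 <= dotv _ _).
rewrite -/(dy k) -!addrA; congr (_ + _).
rewrite -mulmxBr scalemxAr -mulmxDr; congr (_ *m _).
by rewrite /dx; apply/matrixP => i j; rewrite !mxE; ring.
Qed.

Let xE k : x k - xs = x k.+1 - xs + dx k.
Proof. by rewrite /dx [RHS]addrC subrKA. Qed.

Let yE k : y k - ys = yb k - ys + dy k.
Proof. by rewrite /dy [RHS]addrC subrKA. Qed.

Let yE' k : y k.+1 - ys = yb k - ys - (2 - theta) *: wsc tau (K *m dx k).
Proof.
rewrite y_upd /dx -(opprB (x k.+1)) mulmxN.
by move: (K *m _) => v; apply/matrixP => i j; rewrite !mxE; ring.
Qed.

Lemma fejer k : V k.+1 + decr (dx k) (dy k) <= V k.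
Proof. by rewrite /V yE' (xE k) (yE k); exact: lyap_descent. Qed.

Lemma fejer_cvg : exists l : R, V k @[k --> \oo] --> l.
Proof.
exists (inf (range V)); apply: nonincreasing_cvgn.
  apply/nonincreasing_seqP => k.
  by have := fejer k; have := decr_ge0 (dx k) (dy k); lra.
by exists 0 => _ [k _ <-]; exact: lyap_ge0.
Qed.

Lemma fejer_le0 k : V k <= V 0.
Proof.
elim: k => // k; apply: le_trans.
by have := fejer k; have := decr_ge0 (dx k) (dy k); lra.
Qed.

Lemma fejer_decr : decr (dx k) (dy k) @[k --> \oo] --> 0.
Proof.
have [l Vl] := fejer_cvg.
have Vl1 : V k.+1 @[k --> \oo] --> l by rewrite (cvg_shiftS V).
have : V k - V k.+1 @[k --> \oo] --> 0 by rewrite -(subrr l); exact: cvgB.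
apply: squeeze_cvgr (cvg_cst 0) => //; apply: nearW => k.
by rewrite decr_ge0 /=; have := fejer k; lra.
Qed.

(** The index is shifted because at theta = 2 the value [V k] need not control its own iterate,
    while the resolvent bound controls the next one. *)
Lemma next_bound : exists2 G : R, 0 <= G & forall k,
  dotv (x k.+1 - xs) (x k.+1 - xs) + dotv (y k.+1 - ys) (y k.+1 - ys) <= G * V k.
Proof.
have [t2|t2] := eqVneq theta 2.
  have [G1 G10 H1] := wdot_coercive si_gt0.
  have [G2 G20 H2] := wdot_coercive ti_gt0.
  exists (G1 * 2 + G2 * 18) => [|k]; first by rewrite addr_ge0 // mulr_ge0.
  have [h1 h2] := resolvent_bound2 t2 (mono_x k) (mono_y k).
  rewrite -xE -yE -/(V k) in h1 h2.
  have -> : y k.+1 - ys = yb k - ys by rewrite yE' t2 subrr scale0r subr0.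
  rewrite mulrDl -!mulrA; apply: lerD.
    by apply: le_trans (H1 _) _; exact: ler_wpM2l.
  by apply: le_trans (H2 _) _; exact: ler_wpM2l.
have [G G0 H] := lyap_coercive t2; exists G => // k.
apply: le_trans (H _ _) _; apply: ler_wpM2l => //.
by have := fejer k; have := decr_ge0 (dx k) (dy k); rewrite /V; lra.
Qed.

Let decr_part (a : nat -> R) : (forall k, 0 <= a k <= decr (dx k) (dy k)) ->
  a k @[k --> \oo] --> 0.
Proof.
by move=> h; apply: squeeze_cvgr (cvg_cst 0) fejer_decr; apply: nearW.
Qed.

Lemma dual_gap_cvg : dy k - wsc tau (K *m dx k) @[k --> \oo] --> (0 : 'cV[R]_d).
Proof.
have [G G0 H] := wdot_coercive ti_gt0.
have : G * wdot ti (dy k - wsc tau (K *m dx k)) (dy k - wsc tau (K *m dx k))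
    @[k --> \oo] --> 0.
  rewrite -(mulr0 G); apply: cvgM; first exact: cvg_cst.
  apply: decr_part => k; rewrite wdot_ge0 //=.
  have := decr_ge (dx k) (dy k); have := mulr_ge0 eta_ge0 (dotv_ge0 (dx k)); lra.
by apply: cvg_dotv0; apply: nearW => k; exact: H.
Qed.

Lemma primal_gap_cvg : theta != 2 -> dx k @[k --> \oo] --> (0 : 'cV[R]_m).
Proof.
move=> /eta_gt0 e0.
have : eta^-1 * (eta * dotv (dx k) (dx k)) @[k --> \oo] --> 0.
  rewrite -(mulr0 eta^-1); apply: cvgM; first exact: cvg_cst.
  apply: decr_part => k; rewrite mulr_ge0 ?dotv_ge0 //=.
  apply: le_trans (decr_ge (dx k) (dy k)); rewrite lerDl; exact: wdot_ge0.
by apply: cvg_dotv0; apply: nearW => k; rewrite mulKf // gt_eqF.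
Qed.

(** The factor 2 - theta vanishes exactly where [dx] need not tend to 0, so this limit holds in all
    cases. *)
Lemma scaled_gap_cvg : (2 - theta) *: dx k @[k --> \oo] --> (0 : 'cV[R]_m).
Proof.
have [->|t2] := eqVneq theta 2.
  by under eq_fun do rewrite subrr scale0r; exact: cvg_cst.
by rewrite -(scaler0 _ (2 - theta)); apply: cvgZr; exact: primal_gap_cvg.
Qed.

(* At theta = 2 the differences dx need not vanish, but their image under the
   positive semidefinite operator S^-1 - K^T T K does, by Cauchy-Schwarz. *)
Lemma primal_residual_cvg :
  wsc si (dx k) - K^T *m wsc tau (K *m dx k) @[k --> \oo] --> (0 : 'cV[R]_m).
Proof.
have [t2|t2] := eqVneq theta 2; last first.
  have dx0 := primal_gap_cvg t2.
  have -> : (0 : 'cV[R]_m) = wsc si 0 - K^T *m wsc tau (K *m 0).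
    rewrite mulmx0; have w0 k (w : 'I_k -> R) : wsc w 0 = 0.
      by apply/matrixP => i j; rewrite !mxE mulr0.
    by rewrite !w0 mulmx0 subr0.
  apply: cvgB; first exact: cvg_wsc.
  by apply: cvg_mulmx; apply: cvg_wsc; exact: cvg_mulmx.
apply/cvg_mxP => i j; rewrite (ord1 j) mxE.
pose ei : 'cV[R]_m := delta_mx i 0.
have eiE u : dotv u ei = u i 0.
  rewrite dotvE (bigD1 i) //= big1 ?addr0 => [|l li]; first by rewrite mxE !eqxx mulr1.
  by rewrite mxE (negPf li) mulr0.
have SE u : (wsc si u - K^T *m wsc tau (K *m u)) i 0 = S u ei.
  by rewrite -eiE dotvBl dotv_mulmx trmxK.
have : S (dx k) (dx k) * S ei ei @[k --> \oo] --> 0.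
  rewrite -(mul0r (S ei ei)); apply: cvgM; last exact: cvg_cst.
  apply: decr_part => k; rewrite S_ge0 //=.
  rewrite /decr /S /c t2; have := wdot_ge0 (dy k - wsc tau (K *m dx k)) ti_gt0; lra.
apply: cvg_sqr0; apply: nearW => k; rewrite SE.
apply: discriminant_le0 => [|t]; first exact: S_ge0.
by rewrite -S_sub; exact: S_ge0.
Qed.

End Fejer.

Theorem primal_dual_cvg : (exists xs ys, saddle xs ys) ->
  exists xl yl, saddle xl yl /\ x k @[k --> \oo] --> xl.
Proof.
move=> [xs [ys sad]].
(* An ultrafilter finer than [\oo] plays the part of a convergent subsequence. *)
have [U [UU Uoo]] := @ultraFilterLemma nat \oo _.
have toU (T : topologicalType) (u : nat -> T) (l : T) :
    u k @[k --> \oo] --> l -> u k @[k --> U] --> l.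
  by move=> ul; exact: cvg_trans (cvg_app _ Uoo) ul.
have [G G0 HG] := next_bound sad.
have bnd k : dotv (x k.+1 - xs) (x k.+1 - xs) + dotv (y k.+1 - ys) (y k.+1 - ys)
    <= G * lyap (x 0 - xs) (y 0 - ys).
  by apply: le_trans (HG k) _; apply: ler_wpM2l => //; exact: fejer_le0.
have [xl xU] : exists l : 'cV[R]_m, x k.+1 @[k --> U] --> l.
  have [l xl] : exists l : 'cV[R]_m, x k.+1 - xs @[k --> U] --> l.
    apply: ultrafilter_cvgv; apply: nearW => k; apply: le_trans (bnd k).
    by rewrite lerDl dotv_ge0.
  exists (l + xs); under eq_fun do rewrite -[x _](subrK xs).
  by apply: cvgD => //; exact: cvg_cst.
have [yl yU] : exists l : 'cV[R]_d, y k.+1 @[k --> U] --> l.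
  have [l xl'] : exists l : 'cV[R]_d, y k.+1 - ys @[k --> U] --> l.
    apply: ultrafilter_cvgv; apply: nearW => k; apply: le_trans (bnd k).
    by rewrite lerDr dotv_ge0.
  exists (l + ys); under eq_fun do rewrite -[y _](subrK ys).
  by apply: cvgD => //; exact: cvg_cst.
have sg := scaled_gap_cvg sad; have dg := dual_gap_cvg sad.
have w0 k (w : 'I_k -> R) : wsc w 0 = 0.
  by apply/matrixP => i j; rewrite !mxE mulr0.
have sg' : K *m ((2 - theta) *: dx k) @[k --> \oo] --> (0 : 'cV[R]_d).
  by rewrite -(mulmx0 _ K); exact: cvg_mulmx.
(* [yb k] and [y k.+1] differ by a multiple of T K dx with factor 2 - theta, which tends to 0. *)
have ybU : yb k @[k --> U] --> yl.
  have -> : yb = fun k => y k.+1 + wsc tau (K *m ((2 - theta) *: dx k)).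
    apply/funext => k; rewrite y_upd -scalemxAr wscZ /dx -(opprB (x k.+1)) mulmxN.
    by move: (K *m _) => v; apply/matrixP => i j; rewrite !mxE; ring.
  rewrite -[yl]addr0 -(w0 _ tau); apply: cvgD => //.
  by apply: cvg_wsc; exact: toU.
have sad' : saddle xl yl.
  split.
    apply: (A_closed _ xU _ x_incl).
    (* The subgradient is - K^T yb plus two residuals already known to vanish. *)
    have -> : (fun k => wsc si (x k - x k.+1) - K^T *m y k) = fun k =>
       (wsc si (dx k) - K^T *m wsc tau (K *m dx k))
       - K^T *m (dy k - wsc tau (K *m dx k)) - K^T *m yb k.
      apply/funext => k; rewrite -/(dx k).
      have -> : y k = dy k + yb k by rewrite subrK.
      rewrite mulmxDr (mulmxBr _ (dy k) (wsc _ _)).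
      move: (wsc si _) (K^T *m wsc _ _) (K^T *m dy k) (K^T *m yb k) => a b p q.
      by apply/matrixP => i j; rewrite !mxE; ring.
    have -> : - (K^T *m yl) = 0 - K^T *m 0 - K^T *m yl by rewrite mulmx0 subr0 sub0r.
    apply: cvgB; last exact: cvg_mulmx.
    apply: cvgB; first by apply: toU; exact: (primal_residual_cvg sad).
    by apply: cvg_mulmx; exact: toU.
  apply: (B_closed _ _ ybU y_incl).
  (* Moving K dx out of T^-1 dy leaves the vanishing dual gap, and K dx merges with the extrapolated
     point into K ((2 - theta) dx + x^{k+1}). *)
  have -> : (fun k => wsc ti (y k - yb k) + K *m (theta *: x k.+1 + (1 - theta) *: x k))
    = fun k => wsc ti (dy k - wsc tau (K *m dx k)) + K *m ((2 - theta) *: dx k) + K *m x k.+1.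
    apply/funext => k; rewrite -/(dy k) (wscB _ (dy k)).
    have -> : wsc ti (wsc tau (K *m dx k)) = K *m dx k.
      by apply/matrixP => i j; rewrite !mxE /ti (ord1 j) mulKf // gt_eqF.
    rewrite -!addrA; congr (_ + _); rewrite -mulmxN -!mulmxDr; congr (_ *m _).
    by rewrite /dx; apply/matrixP => i j; rewrite !mxE; ring.
  have -> : K *m xl = wsc ti 0 + 0 + K *m xl by rewrite w0 !add0r.
  apply: cvgD; last exact: cvg_mulmx.
  apply: cvgD; last exact: toU.
  by apply: cvg_wsc; exact: toU.
exists xl, yl; split=> //.
have [l Vl] := fejer_cvg sad'.
have Vl1 : lyap (x k.+1 - xl) (y k.+1 - yl) @[k --> \oo] --> l.
  by rewrite (cvg_shiftS (fun k => lyap (x k - xl) (y k - yl))).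
(* The Lyapunov values converge along [\oo], and continuity identifies their limit along [U] as the
   value at zero error. *)
have l0 : l = 0.
  apply: (cvg_unique (@Rhausdorff R) (toU _ _ _ Vl1)).
  have -> : (0 : R) = lyap 0 0.
    by rewrite /lyap /wdot mulmx0 !w0 !subr0 !w0 !dot0v mulr0 !addr0.
  have xU0 : x k.+1 - xl @[k --> U] --> (0 : 'cV[R]_m).
    by rewrite -(subrr xl); apply: cvgB => //; exact: cvg_cst.
  have yU0 : y k.+1 - yl @[k --> U] --> (0 : 'cV[R]_d).
    by rewrite -(subrr yl); apply: cvgB => //; exact: cvg_cst.
  have kU0 := @cvg_mulmx _ _ U _ _ _ K _ _ xU0.
  have qU0 : (y k.+1 - yl) - wsc tau (K *m (x k.+1 - xl)) @[k --> U] -->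
    (0 - wsc tau (K *m 0) : 'cV[R]_d).
    by apply: cvgB; [exact: yU0|apply: cvg_wsc; exact: kU0].
  apply: cvgD; last by apply: cvg_dotv; [apply: cvg_wsc; exact: qU0|exact: qU0].
  apply: cvgD; first by apply: cvg_dotv; [apply: cvg_wsc; exact: xU0|exact: xU0].
  by apply: cvgM; [exact: cvg_cst|apply: cvg_dotv; [apply: cvg_wsc; exact: kU0|exact: kU0]].
have [G' G'0 HG'] := next_bound sad'.
rewrite -(cvg_shiftS x).
have xl0 : x k.+1 - xl @[k --> \oo] --> (0 : 'cV[R]_m).
  have : G' * lyap (x k - xl) (y k - yl) @[k --> \oo] --> 0.
    by rewrite -(mulr0 G') -l0; apply: cvgM => //; exact: cvg_cst.
  apply: cvg_dotv0; apply: nearW => k; apply: le_trans (HG' k).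
  by rewrite lerDl dotv_ge0.
rewrite -[xl]add0r /=; under eq_fun do rewrite -[x _](subrK xl).
by apply: cvgD => //; exact: cvg_cst.
Qed.

End PrimalDual.

(** * Block vectors and the graph *)

Section Blocks.
Context {R : realType} {N : nat}.
Implicit Types n : nat.

Definition xblk n (v : 'cV[R]_(N * n)) (i : 'I_N) : 'cV[R]_n :=
  \col_a v (mxtens_index (i, a)) 0.

Definition ystack (r : 'I_N -> nat) (y : forall i, 'cV[R]_(r i)) :
  'cV[R]_(\sum_i r i) := \col_s y (tagnat.sig1 s) (tagnat.sig2 s) 0.

Definition yblk (r : 'I_N -> nat) (v : 'cV[R]_(\sum_i r i)) (i : 'I_N) :
  'cV[R]_(r i) := \col_a v (tagnat.Rank i a) 0.

(** The type of [tagnat.sig2] depends on [tagnat.sig1], so the two cannot be rewritten separately;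
    packing them into a sigma type allows one rewrite. *)
Lemma sig_Rank (r : 'I_N -> nat) (T : Type) (Q : forall i, 'I_(r i) -> T) i
    (a : 'I_(r i)) :
  Q (tagnat.sig1 (tagnat.Rank i a)) (tagnat.sig2 (tagnat.Rank i a)) = Q i a.
Proof.
pose G (t : {i & 'I_(r i)}) := Q (tag t) (tagged t).
by rewrite -[LHS]/(G (tagnat.sig (tagnat.Rank i a))) tagnat.rankK.
Qed.

Lemma stackK n (x : 'I_N -> 'cV[R]_n) i : xblk (stack x) i = x i.
Proof. by apply/matrixP => a b; rewrite (ord1 b) !mxE mxtens_indexK. Qed.

Lemma xblkK n (v : 'cV[R]_(N * n)) : stack (xblk v) = v.
Proof.
apply/matrixP => s b; rewrite (ord1 b) !mxE -surjective_pairing.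
by rewrite mxtens_unindexK.
Qed.

Lemma ystackK (r : 'I_N -> nat) (y : forall i, 'cV[R]_(r i)) i :
  yblk (ystack y) i = y i.
Proof.
apply/matrixP => a b; rewrite (ord1 b) !mxE.
exact: (@sig_Rank r R (fun i a => y i a 0)).
Qed.

Lemma yblkK (r : 'I_N -> nat) (v : 'cV[R]_(\sum_i r i)) : ystack (yblk v) = v.
Proof. by apply/matrixP => s b; rewrite (ord1 b) !mxE tagnat.sig2K. Qed.

Lemma big_mxtens n (F : 'I_(N * n) -> R) :
  \sum_s F s = \sum_i \sum_a F (mxtens_index (i, a)).
Proof.
rewrite (reindex (@mxtens_index N n)) /=; last first.
  by apply: onW_bij; exists (@mxtens_unindex N n); [exact: mxtens_indexK|exact: mxtens_unindexK].
by rewrite pair_big /=; apply: eq_bigr => -[].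
Qed.

Lemma big_Rank (r : 'I_N -> nat) (F : 'I_(\sum_i r i) -> R) :
  \sum_s F s = \sum_i \sum_(a < r i) F (tagnat.Rank i a).
Proof.
rewrite (reindex _ tagnat.rank_bij_on) /= sig_big_dep /=.
by apply: eq_bigr => -[].
Qed.

Lemma dotv_xblk n (u v : 'cV[R]_(N * n)) :
  dotv u v = \sum_i dotv (xblk u i) (xblk v i).
Proof.
rewrite dotvE big_mxtens; apply: eq_bigr => i _; rewrite dotvE.
by apply: eq_bigr => a _; rewrite !mxE.
Qed.

Lemma dotv_yblk (r : 'I_N -> nat) (u v : 'cV[R]_(\sum_i r i)) :
  dotv u v = \sum_i dotv (yblk u i) (yblk v i).
Proof.
rewrite dotvE big_Rank; apply: eq_bigr => i _; rewrite dotvE.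
by apply: eq_bigr => a _; rewrite !mxE.
Qed.

Lemma xblkD n (u v : 'cV[R]_(N * n)) i : xblk (u + v) i = xblk u i + xblk v i.
Proof. by apply/matrixP => a b; rewrite !mxE. Qed.

Lemma xblkN n (u : 'cV[R]_(N * n)) i : xblk (- u) i = - xblk u i.
Proof. by apply/matrixP => a b; rewrite !mxE. Qed.

Lemma xblkZ n c (u : 'cV[R]_(N * n)) i : xblk (c *: u) i = c *: xblk u i.
Proof. by apply/matrixP => a b; rewrite !mxE. Qed.

Lemma yblkD (r : 'I_N -> nat) (u v : 'cV[R]_(\sum_i r i)) i :
  yblk (u + v) i = yblk u i + yblk v i.
Proof. by apply/matrixP => a b; rewrite !mxE. Qed.

Lemma yblkN (r : 'I_N -> nat) (u : 'cV[R]_(\sum_i r i)) i :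
  yblk (- u) i = - yblk u i.
Proof. by apply/matrixP => a b; rewrite !mxE. Qed.

Lemma yblkZ (r : 'I_N -> nat) c (u : 'cV[R]_(\sum_i r i)) i :
  yblk (c *: u) i = c *: yblk u i.
Proof. by apply/matrixP => a b; rewrite !mxE. Qed.

Lemma cvg_xblk (T : Type) (F : set_system T) (FF : Filter F) n
    (u : T -> 'cV[R]_(N * n)) (l : 'cV[R]_(N * n)) i :
  u t @[t --> F] --> l -> xblk (u t) i @[t --> F] --> xblk l i.
Proof.
move=> /cvg_mxP ul; apply/cvg_mxP => a b; under eq_fun do rewrite mxE.
by rewrite mxE; exact: ul.
Qed.

Lemma cvg_yblk (T : Type) (F : set_system T) (FF : Filter F)
    (r : 'I_N -> nat) (u : T -> 'cV[R]_(\sum_i r i)) l i :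
  u t @[t --> F] --> l -> yblk (u t) i @[t --> F] --> yblk l i.
Proof.
move=> /cvg_mxP ul; apply/cvg_mxP => a b; under eq_fun do rewrite mxE.
by rewrite mxE; exact: ul.
Qed.

Lemma yblk_blkdiag n (r : 'I_N -> nat) (C : forall i, 'M[R]_(r i, n)) v i :
  yblk (blkdiag C *m v) i = C i *m xblk v i.
Proof.
apply/matrixP => a b; rewrite (ord1 b) !mxE big_mxtens (bigD1 i) //=.
rewrite [X in _ + X]big1 ?addr0 => [|j ji].
  apply: eq_bigr => t _; rewrite !mxE mxtens_indexK /=.
  by rewrite (@sig_Rank r R (fun i' a' => C i' a' t *+ (i' == i))) eqxx.
apply: big1 => t _; rewrite !mxE mxtens_indexK /=.
rewrite (@sig_Rank r R (fun i' a' => C i' a' t *+ (i' == j))).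
by rewrite eq_sym (negPf ji) mul0r.
Qed.

Lemma xblk_blkdiagT n (r : 'I_N -> nat) (C : forall i, 'M[R]_(r i, n)) w i :
  xblk ((blkdiag C)^T *m w) i = (C i)^T *m yblk w i.
Proof.
apply/matrixP => a b; rewrite (ord1 b) !mxE big_Rank (bigD1 i) //=.
rewrite [X in _ + X]big1 ?addr0 => [|j ji].
  apply: eq_bigr => t _; rewrite !mxE mxtens_indexK /=.
  by rewrite (@sig_Rank r R (fun i' a' => C i' a' a *+ (i' == i))) eqxx.
apply: big1 => t _; rewrite !mxE mxtens_indexK /=.
by rewrite (@sig_Rank r R (fun i' a' => C i' a' a *+ (i' == i))) (negPf ji) mul0r.
Qed.

Lemma block_colT n m (A : 'M[R]_(m, N * n)) w i :
  (block_col A i)^T *m w = xblk (A^T *m w) i.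
Proof. by apply/matrixP => a b; rewrite (ord1 b) !mxE; apply: eq_bigr => s _; rewrite !mxE. Qed.

Lemma sum_block_col n m (A : 'M[R]_(m, N * n)) (z : 'I_N -> 'cV[R]_n) :
  \sum_i block_col A i *m z i = A *m stack z.
Proof.
apply/matrixP => a b; rewrite (ord1 b) summxE mxE big_mxtens.
apply: eq_bigr => i _; rewrite mxE; apply: eq_bigr => t _.
by rewrite !mxE mxtens_indexK.
Qed.

Variables (M : nat) (ends : 'I_M -> 'I_N * 'I_N).

Lemma consensusE n (v : 'cV[R]_(N * n)) l a :
  (consensus_mx n ends *m v) (mxtens_index (l, a)) 0 =
  xblk v (ends l).1 a 0 - xblk v (ends l).2 a 0.
Proof.
rewrite mxE big_mxtens.
under eq_bigr => i _.
  under eq_bigr => b _ do rewrite /consensus_mx tensmxE !mxE.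
  rewrite (bigD1 a) //= eqxx mulr1 big1 => [|b ba]; last first.
    by rewrite (eq_sym a b) (negPf ba) mulr0 mul0r.
  rewrite addr0 mulrBl; over.
have pick i0 : \sum_i (i == i0)%:R * v (mxtens_index (i, a)) 0 =
    v (mxtens_index (i0, a)) 0.
  rewrite (bigD1 i0) //= eqxx mul1r big1 ?addr0 // => i ie.
  by rewrite (negPf ie) mul0r.
by rewrite sumrB !mxE !pick.
Qed.

Lemma consensusTE n (w : 'cV[R]_(M * n)) i a :
  xblk ((consensus_mx n ends)^T *m w) i a 0 =
  \sum_l ((i == (ends l).1)%:R - (i == (ends l).2)%:R) * w (mxtens_index (l, a)) 0.
Proof.
rewrite !mxE; transitivity (\sum_l \sum_b ((consensus_mx n ends)^T
   (mxtens_index (i, a)) (mxtens_index (l, b)) * w (mxtens_index (l, b)) 0)).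
  rewrite (reindex (@mxtens_index M n)) /=; last first.
    by apply: onW_bij; exists (@mxtens_unindex M n);
      [exact: mxtens_indexK|exact: mxtens_unindexK].
  by rewrite pair_big /=; apply: eq_bigr => -[].
apply: eq_bigr => l _; rewrite (bigD1 a) //= big1 => [|b ba].
  by rewrite addr0 mxE /consensus_mx tensmxE !mxE eqxx mulr1.
by rewrite mxE /consensus_mx tensmxE !mxE (negPf ba) mulr0 mul0r.
Qed.

(** The mixed-product rule turns (B (x) I)(B^T (x) I) into B B^T (x) I. This is what makes the norm
    of L bound |K v|^2. *)
Lemma Lmx_gram n (r : 'I_N -> nat) (C : forall i, 'M[R]_(r i, n)) :
  Lmx ends C =
  (col_mx (blkdiag C) (consensus_mx n ends))^T *m col_mx (blkdiag C) (consensus_mx n ends).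
Proof.
rewrite tr_col_mx mul_row_col addrC /Lmx; congr (_ + _).
by rewrite /consensus_mx trmx_tens trmxK trmx1 tensmx_mul mulmx1.
Qed.

End Blocks.

(** * The operator norm as a bound on quadratic forms *)

Section OperatorNorm.
Context {R : realType}.

Lemma dotv_le_norm2 n (u v : 'cV[R]_n) : dotv u v <= norm2 u * norm2 v.
Proof.
rewrite /norm2 -sqrtrM ?dotv_ge0 //.
apply: le_trans (ler_norm _) _; rewrite -sqrtr_sqr; apply: ler_wsqrtr.
exact: CauchySchwarz_dotv.
Qed.

(** After Cauchy-Schwarz, v / |v| competes in the supremum defining the norm, which is bounded by
    [mulmx_bounded]. *)
Lemma opnorm_quad n (T : 'M[R]_n) (v : 'cV[R]_n) :
  dotv v (T *m v) <= opnorm T * dotv v v.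
Proof.
have [v0|v0] := eqVneq (norm2 v) 0.
  have /dotv_eq0 -> : dotv v v = 0 by rewrite -sqr_norm2 v0 expr0n.
  by rewrite !dot0v mulr0.
have vp : 0 < norm2 v by rewrite lt_neqAle eq_sym v0 sqrtr_ge0.
apply: le_trans (dotv_le_norm2 _ _) _.
rewrite -sqr_norm2 expr2 mulrCA ler_pM2l // -ler_pdivrMr //.
have [G G0 HG] := mulmx_bounded T.
apply: ub_le_sup.
  exists (Num.sqrt G) => _ [w /= w1 <-]; rewrite /norm2; apply: ler_wsqrtr.
  apply: le_trans (HG w) _; rewrite -[leRHS]mulr1; apply: ler_wpM2l => //.
  by rewrite -sqr_norm2 expr_le1 // sqrtr_ge0.
exists ((norm2 v)^-1 *: v) => /=.
  by rewrite norm2Z ger0_norm ?invr_ge0 ?sqrtr_ge0 // mulVf.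
by rewrite -scalemxAr norm2Z ger0_norm ?invr_ge0 ?sqrtr_ge0 // mulrC.
Qed.

End OperatorNorm.

(** * Edges, neighbours and the weighted Laplacian *)

Section GraphEdges.
Context {R : realType} {N M : nat}.
Variables (e : rel 'I_N) (ends : 'I_M -> 'I_N * 'I_N).
Hypotheses (e_irrefl : irreflexive e) (e_sym : symmetric e).
Hypothesis e_index : edge_indexing e ends.

Let edge l := [set (ends l).1; (ends l).2]%SET.

Let set2_eq (T : finType) (a b c d : T) :
  [set a; b]%SET = [set c; d]%SET -> (a = c /\ b = d) \/ (a = d /\ b = c).
Proof.
move=> /setP E.
have := E a; have := E b; have := E c; have := E d; rewrite !inE !eqxx /= !orbT.
move=> /orP[]/eqP h1 /orP[]/eqP h2 /esym/orP[]/eqP h3 /esym/orP[]/eqP h4; subst; tauto.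
Qed.

Lemma edge_of_rel i j : e i j -> exists l, edge l = [set i; j]%SET.
Proof.
move=> eij; have : [set i; j]%SET \in edge_set e.
  by apply/imsetP; exists (i, j); rewrite ?inE.
by rewrite -e_index.2 => /imsetP[l _ ->]; exists l.
Qed.

Lemma rel_of_edge l : e (ends l).1 (ends l).2.
Proof.
have : edge l \in edge_set e by rewrite -e_index.2; apply/imsetP; exists l.
move=> /imsetP[[i j] /=]; rewrite inE /= => eij /set2_eq [[-> ->] //|[-> ->]].
by rewrite e_sym.
Qed.

(** Each neighbour [j] of [i] corresponds to one index [l], by injectivity of the indexing; without
    loops the two ends of an edge differ, so no edge is counted twice. *)
Lemma sum_neighbors (V : nmodType) (i : 'I_N) (F : 'I_N -> V) :
  \sum_(j | e i j) F j =
  \sum_l (if i == (ends l).1 then F (ends l).2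
          else if i == (ends l).2 then F (ends l).1 else 0).
Proof.
transitivity (\sum_j \sum_(l | edge l == [set i; j]%SET) F j).
  rewrite [LHS]big_mkcond; apply: eq_bigr => j _; case: ifP => eij.
    have [l el] := edge_of_rel eij.
    rewrite (bigD1 l) /= ?el // big1 ?addr0 // => l' /andP[/eqP h].
    by rewrite -el in h; rewrite (e_index.1 _ _ h) eqxx.
  rewrite big_pred0 // => l; apply/negP => /eqP el.
  have := rel_of_edge l; have := set2_eq el.
  by case=> -[-> ->]; rewrite ?(e_sym j) eij.
rewrite (exchange_big_dep xpredT) //=; apply: eq_bigr => l _.
have ne : (ends l).1 != (ends l).2.
  by apply/eqP => h; have := rel_of_edge l; rewrite -h e_irrefl.
case: eqP => [->|n1].
  rewrite (bigD1 (ends l).2) //= big1 ?addr0 // => j /andP[/eqP el jn].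
  case: (set2_eq el) => -[]; first by move=> _ h; rewrite h eqxx in jn.
  by move=> _ h; rewrite h eqxx in ne.
case: eqP => [->|n2].
  rewrite (bigD1 (ends l).1) /=; last by rewrite /edge finset.setUC.
  rewrite big1 ?addr0 // => j /andP[/eqP el jn].
  case: (set2_eq el) => -[]; last by move=> h; rewrite h eqxx in jn.
  by move=> h; rewrite h eqxx in ne.
by apply: big1 => j /eqP /set2_eq [][h1 h2]; [case: n1|case: n2].
Qed.

(** Identifies the neighbour sum of the algorithm with a block of A^T Pi A u, so that the update of
    rho comes from an update of edge variables. *)
Lemma laplacian_step n (kappa : 'I_N -> 'I_N -> R) (pi_ : 'I_M -> R)
    (u : 'I_N -> 'cV[R]_n) i :
  (forall l, kappa (ends l).1 (ends l).2 = pi_ l /\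
             kappa (ends l).2 (ends l).1 = pi_ l) ->
  xblk ((consensus_mx n ends)^T *m
     wsc (fun s => pi_ (mxtens_unindex s).1) (consensus_mx n ends *m stack u)) i =
  \sum_(j | e i j) kappa i j *: (u i - u j).
Proof.
move=> kp; rewrite sum_neighbors; apply/matrixP => a b; rewrite (ord1 b).
rewrite consensusTE summxE; apply: eq_bigr => l _.
rewrite mxE mxtens_indexK consensusE !stackK /=.
have ne : (ends l).1 != (ends l).2.
  by apply/eqP => h; have := rel_of_edge l; rewrite -h e_irrefl.
have [k1 k2] := kp l.
case: eqP => [->|_].
  by rewrite (negPf ne) !mxE k1 subr0 mul1r.
case: eqP => [->|_]; first by rewrite !mxE k2 sub0r mulr1n; ring.
by rewrite mxE subrr mul0r.
Qed.

(** Equality across each edge propagates along paths. *)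
Lemma consensus_eq n (v : 'cV[R]_(N * n)) : (forall i j, connect e i j) ->
  consensus_mx n ends *m v = 0 -> forall i j, xblk v i = xblk v j.
Proof.
move=> econn Av i j; have step a b : e a b -> xblk v a = xblk v b.
  move=> /edge_of_rel[l el]; have lE : xblk v (ends l).1 = xblk v (ends l).2.
    apply/matrixP => t s; rewrite (ord1 s); apply/eqP; rewrite -subr_eq0.
    by rewrite -consensusE Av mxE.
  by case: (set2_eq el) => -[<- <-]; rewrite lE.
have /connectP[p] := econn i j; elim: p i => [i _ -> //|a p IH i /= /andP[ia pa] jl].
by rewrite (step _ _ ia); exact: IH.
Qed.

Lemma consensus_const n (x : 'cV[R]_n) :
  consensus_mx n ends *m stack (fun _ => x) = 0.
Proof.
apply/matrixP => s b; rewrite (ord1 b) -[s]mxtens_unindexK.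
case: (mxtens_unindex s) => l a.
by rewrite consensusE !stackK subrr mxE.
Qed.

End GraphEdges.

(** * Saddle points of the consensus problem *)

Section Saddle.
Context {R : realType} {N M n : nat}.
Variables (e : rel 'I_N) (ends : 'I_M -> 'I_N * 'I_N).
Hypothesis e_conn : forall i j : 'I_N, connect e i j.
Hypothesis e_index : edge_indexing e ends.
Variables (r : 'I_N -> nat) (C : forall i : 'I_N, 'M[R]_(r i, n)).
Variables (f : 'I_N -> 'cV[R]_n -> \bar R)
  (g : forall i : 'I_N, 'cV[R]_(r i) -> \bar R).
Arguments g : clear implicits.
Hypotheses (f_pcc : forall i, pcc_fun (f i)) (g_pcc : forall i, pcc_fun (g i)).

Let A := consensus_mx (R := R) n ends.
Let D := blkdiag C.
Let K := col_mx D A.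

Definition subdiff_f (u p : 'cV[R]_(N * n)) : Prop :=
  forall i, subgrad (f i) (xblk u i) (xblk p i).

(* The subdifferential of (s, t) |-> sum_i g_i(s_i) + indicator of t = 0. *)
Definition subdiff_g (s y : 'cV[R]_(\sum_i r i + M * n)) : Prop :=
  (forall i, subgrad (g i) (yblk (usubmx s) i) (yblk (usubmx y) i)) /\
  dsubmx s = 0.

Lemma subdiff_f_mono u u' p p' :
  subdiff_f u p -> subdiff_f u' p' -> 0 <= dotv (p - p') (u - u').
Proof.
move=> h h'; rewrite dotv_xblk sumr_ge0 // => i _; rewrite !xblkD !xblkN.
exact: subgrad_mono (h i) (h' i).
Qed.

Lemma subdiff_g_mono s s' y y' :
  subdiff_g s y -> subdiff_g s' y' -> 0 <= dotv (s - s') (y - y').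
Proof.
move=> [h d] [h' d']; rewrite -[s - s']vsubmxK -[y - y']vsubmxK dotv_col_mx.
rewrite (linearB (@dsubmx _ _ _ _)) /= d d' subrr dot0v addr0.
rewrite dotv_yblk sumr_ge0 // => i _; rewrite !(linearB (@usubmx _ _ _ _)) /=.
by rewrite !yblkD !yblkN dotvC; exact: subgrad_mono (h i) (h' i).
Qed.

Lemma subdiff_f_closed (F : set_system nat) (FF : ProperFilter F)
    (u p : nat -> 'cV[R]_(N * n)) (lu lp : 'cV[R]_(N * n)) :
  u k @[k --> F] --> lu -> p k @[k --> F] --> lp ->
  (forall k, subdiff_f (u k) (p k)) -> subdiff_f lu lp.
Proof.
move=> ul pl h i; have [qp qcl _] := f_pcc i.
apply: (@subgrad_closed _ _ _ F FF (f i) (fun k => xblk (u k) i)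
  (fun k => xblk (p k) i)) => // [||k]; last exact: h.
  exact: cvg_xblk.
exact: cvg_xblk.
Qed.

Lemma subdiff_g_closed (F : set_system nat) (FF : ProperFilter F)
    (u p : nat -> 'cV[R]_(\sum_i r i + M * n)) (lu lp : 'cV[R]_(\sum_i r i + M * n)) :
  u k @[k --> F] --> lu -> p k @[k --> F] --> lp ->
  (forall k, subdiff_g (u k) (p k)) -> subdiff_g lu lp.
Proof.
have cu (v : nat -> 'cV[R]_(\sum_i r i + M * n)) (l : 'cV[R]_(\sum_i r i + M * n)) :
    v k @[k --> F] --> l -> usubmx (v k) @[k --> F] --> usubmx l.
  move=> /cvg_mxP vl; apply/cvg_mxP => i j; under eq_fun do rewrite mxE.
  by rewrite mxE; exact: vl.
have cd (v : nat -> 'cV[R]_(\sum_i r i + M * n)) (l : 'cV[R]_(\sum_i r i + M * n)) :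
    v k @[k --> F] --> l -> dsubmx (v k) @[k --> F] --> dsubmx l.
  move=> /cvg_mxP vl; apply/cvg_mxP => i j; under eq_fun do rewrite mxE.
  by rewrite mxE; exact: vl.
move=> ul pl h; split=> [i|].
  have [qp qcl _] := g_pcc i.
  apply: (@subgrad_closed _ _ _ F FF (g i) (fun k => yblk (usubmx (u k)) i)
    (fun k => yblk (usubmx (p k)) i)) => // [||k]; last exact: (h k).1.
    by apply: cvg_yblk; exact: cu.
  by apply: cvg_yblk; exact: cu.
apply: (@cvg_unique _ (@norm_hausdorff _ _) _ _ _ _ (cd _ _ ul)).
have -> : (fun k => dsubmx (u k)) = fun=> 0 by apply/funext => k; exact: (h k).2.
exact: cvg_cst.
Qed.

Let objective (x : 'cV[R]_n) : \bar R := (\sum_(i < N) (f i x + g i (C i *m x)%R))%E.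

(** Properness keeps [-oo] out of the sum, so a single infinite term makes it infinite. *)
Lemma objective_lty x : (objective x < +oo)%E <->
  forall i, edom (f i) x /\ edom (g i) (C i *m x).
Proof.
have fN i z : f i z != -oo%E by have [[]] := f_pcc i.
have gN i z : g i z != -oo%E by have [[]] := g_pcc i.
split=> [h i|h]; last first.
  by apply: lte_sum_pinfty => i _; apply: lte_add_pinfty; have [] := h i.
have : (f i x + g i (C i *m x)%R < +oo)%E.
  rewrite ltey; apply/eqP => hi.
  have : objective x = +oo%E.
    apply/esum_eqyP; last by exists i; split => //; rewrite mem_index_enum.
    by move=> j _; rewrite adde_eq_ninfty negb_or fN gN.
  by move=> E; rewrite E ltxx in h.
rewrite /edom /=; move: (fN i x) (gN i (C i *m x)).
by case: (f i x) => [a||] //; case: (g i _) => [b||] //; rewrite ?ltry.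
Qed.

(** The subgradient inequalities at the consensus point are summed. For a constant stack h the
    linear terms give - <v, K h> + <v, (D h, 0)>, which is 0 because A h = 0. *)
Lemma saddle_minimizer u v : (0 < N)%N -> saddle K subdiff_f subdiff_g u v ->
  exists2 xs, minimizers objective xs & u = stack (fun _ : 'I_N => xs).
Proof.
move=> N0 [hf [hg hd]]; pose i0 := Ordinal N0.
rewrite mul_col_mx col_mxKu col_mxKd in hg hd.
have uE : u = stack (fun _ : 'I_N => xblk u i0).
  rewrite -[LHS]xblkK; congr stack; apply/funext => i.
  exact: (consensus_eq e_index e_conn hd).
exists (xblk u i0) => // z; set xs := xblk u i0 in uE *.
have xE i : xblk u i = xs by rewrite uE stackK.
pose p i := xblk (- (K^T *m v)) i.
pose q i := yblk (usubmx v) i.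
have Hf i : exists c, f i xs = c%:E /\ forall z, ((c + dotv (p i) (z - xs))%:E <= f i z)%E.
  by have [c h1 h2] := hf i; rewrite xE in h1 h2; exists c.
have Hg i : exists c, g i (C i *m xs) = c%:E /\
    forall z, ((c + dotv (q i) (z - C i *m xs))%:E <= g i z)%E.
  have := hg i; rewrite yblk_blkdiag xE => -[c h1 h2].
  by exists c.
have [cf Hcf] := choice Hf; have [cg Hcg] := choice Hg.
have -> : objective xs = (\sum_i (cf i + cg i))%:E.
  rewrite -sumEFin; apply: eq_bigr => i _.
  by rewrite (Hcf i).1 (Hcg i).1 EFinD.
have l0 : \sum_i (dotv (p i) (z - xs) + dotv (q i) (C i *m z - C i *m xs)) = 0.
  rewrite big_split /=.
  pose h := stack (fun _ : 'I_N => z - xs).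
  have -> : \sum_i dotv (p i) (z - xs) = dotv (- (K^T *m v)) h.
    by rewrite dotv_xblk; apply: eq_bigr => i _; rewrite stackK.
  have -> : \sum_i dotv (q i) (C i *m z - C i *m xs) = dotv (usubmx v) (D *m h).
    by rewrite dotv_yblk; apply: eq_bigr => i _; rewrite yblk_blkdiag stackK mulmxBr.
  rewrite dotvNl dotv_mulmx trmxK mul_col_mx consensus_const.
  by rewrite -{1}[v]vsubmxK dotv_col_mx dotv0 addr0 addNr.
have -> : \sum_i (cf i + cg i) = \sum_i (cf i + cg i
    + (dotv (p i) (z - xs) + dotv (q i) (C i *m z - C i *m xs))).
  by rewrite [RHS]big_split /= l0 addr0.
rewrite -sumEFin; apply: lee_sum => i _.
have := leeD ((Hcf i).2 z) ((Hcg i).2 (C i *m z)); apply: le_trans.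
by rewrite -EFinD lee_fin; lra.
Qed.

(** The variables x and s are separated and tied by the scalar equations (s, 0) = K x. The
    multipliers form the dual vector, and varying one block at a time splits the resulting
    inequality into the individual subgradient inequalities. *)
Lemma saddle_exists (xs : 'cV[R]_n) (z : 'I_N -> 'cV[R]_n) : (0 < N)%N ->
  minimizers objective xs ->
  (forall i, relint (edom (f i)) (z i) /\ relint (edom (g i)) (C i *m z i)) ->
  A *m stack z = 0 ->
  exists u v, saddle K subdiff_f subdiff_g u v.
Proof.
move=> N0 xmin zri Az; pose i0 := Ordinal N0.
have zE i : z i = z i0.
  by have := consensus_eq e_index e_conn Az i i0; rewrite !stackK.
have xdom i : edom (f i) xs /\ edom (g i) (C i *m xs).
  apply: (objective_lty xs).1; apply: le_lt_trans (xmin (z i0)) _.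
  apply/objective_lty => j; have [[h1 _] [h2 _]] := zri j.
  by rewrite -(zE j).
pose X : Type := ('cV[R]_(N * n) * 'cV[R]_(\sum_i r i))%type.
pose b (j : 'I_(\sum_i r i + M * n)) (p : X) : R := (col_mx p.2 0 - K *m p.1) j 0.
pose dom (p : X) := forall i, edom (f i) (xblk p.1 i) /\ edom (g i) (yblk p.2 i).
pose phi (p : X) : R := \sum_i (fine (f i (xblk p.1 i)) + fine (g i (yblk p.2 i))).
pose sz := D *m stack z.
have bz : col_mx sz 0 - K *m stack z = 0 by rewrite mul_col_mx Az subrr.
pose p0 : X := (stack (fun=> xs), D *m stack (fun=> xs)).
have Kp0 : col_mx p0.2 0 - K *m p0.1 = 0.
  by rewrite mul_col_mx consensus_const subrr.
(* Prolonging beyond the feasible point (z, C z) reverses the constraint values, since these are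
   linear and vanish there. *)
have strict p : dom p -> exists (eps : R) p',
    [/\ 0 < eps, dom p' & forall j, b j p' = - eps * b j p].
  move=> dp.
  have : \forall eps \near 0^'+, 0 < eps /\
      dom (stack z - eps *: (p.1 - stack z), sz - eps *: (p.2 - sz)).
    have H : \forall eps \near 0^'+, forall i,
        edom (f i) (z i - eps *: (xblk p.1 i - z i)) /\
        edom (g i) (C i *m z i - eps *: (yblk p.2 i - C i *m z i)).
      apply: filter_forall => i; have [h1 h2] := zri i; have [d1 d2] := dp i.
      by near=> eps; split; near: eps; apply: relint_edom_extend.
    near=> eps; split; first by near: eps; exact: nbhs_right_gt.
    move=> i; rewrite /= !(xblkD, xblkN, xblkZ, yblkD, yblkN, yblkZ).
    rewrite yblk_blkdiag !stackK; move: i; near: eps; exact: H.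
  move=> /filter_ex[eps [eps0 dp']].
  exists eps, (stack z - eps *: (p.1 - stack z), sz - eps *: (p.2 - sz)).
  split=> // j; rewrite /b /=.
  have -> : col_mx (sz - eps *: (p.2 - sz)) 0 - K *m (stack z - eps *: (p.1 - stack z))
     = (1 + eps) *: (col_mx sz 0 - K *m stack z) - eps *: (col_mx p.2 0 - K *m p.1).
    rewrite mulmxBr -scalemxAr mulmxBr.
    move: (K *m _) (K *m p.1) => a c; apply/matrixP => i k; rewrite !mxE.
    by case: splitP => l _; rewrite ?mxE; ring.
  by rewrite bz scaler0 sub0r !mxE mulNr.
have cvx (p p' : X) (t : R) : dom p -> dom p' -> 0 < t < 1 -> exists q : X,
    [/\ dom q, phi q <= t * phi p + (1 - t) * phi p' &
        forall j, b j q = t * b j p + (1 - t) * b j p'].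
  move=> dp dp' t01.
  exists (t *: p.1 + (1 - t) *: p'.1, t *: p.2 + (1 - t) *: p'.2).
  have hf i := edom_convex (f_pcc i) (dp i).1 (dp' i).1 t01.
  have hg i := edom_convex (g_pcc i) (dp i).2 (dp' i).2 t01.
  split.
  - move=> i; rewrite /= !(xblkD, xblkZ, yblkD, yblkZ); split; first exact: (hf i).1.
    exact: (hg i).1.
  - rewrite /phi !mulr_sumr -big_split /=; apply: ler_sum => i _.
    rewrite !(xblkD, xblkZ, yblkD, yblkZ).
    by have := (hf i).2; have := (hg i).2; lra.
  - move=> j; rewrite /b /= mulmxDr -!scalemxAr.
    move: (K *m p.1) (K *m p'.1) => a c; rewrite !mxE.
    by case: splitP => l _; rewrite ?mxE; ring.
have fin_obj (x : 'cV[R]_n) : (forall i, edom (f i) x /\ edom (g i) (C i *m x)) ->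
    objective x = (\sum_i (fine (f i x) + fine (g i (C i *m x))))%:E.
  move=> h; rewrite -sumEFin; apply: eq_bigr => i _; have [h1 h2] := h i.
  by rewrite {1}(edom_fine (f_pcc i) h1) {1}(edom_fine (g_pcc i) h2) EFinD.
(* Feasible pairs are consensus points with s = C x, on which [phi] is the objective. *)
have low p : dom p -> (forall j, j \in index_enum _ -> b j p = 0) -> phi p0 <= phi p.
  move=> dp bp.
  have /eqP : col_mx p.2 0 - K *m p.1 = 0.
    apply/matrixP => j k; rewrite (ord1 k) [RHS]mxE; apply: bp.
    exact: mem_index_enum.
  rewrite subr_eq0 mul_col_mx => /eqP /eq_col_mx [p2E /esym Ap1].
  have xE i := consensus_eq e_index e_conn Ap1 i i0.
  have yE i : yblk p.2 i = C i *m xblk p.1 i0 by rewrite p2E yblk_blkdiag xE.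
  have dx i : edom (f i) (xblk p.1 i0) /\ edom (g i) (C i *m xblk p.1 i0).
    by have := dp i; rewrite xE yE.
  have := xmin (xblk p.1 i0); rewrite (fin_obj _ dx) (fin_obj _ xdom) lee_fin.
  rewrite /phi /p0 /=.
  under [X in _ -> X <= _]eq_bigr do rewrite stackK yblk_blkdiag stackK.
  by under [X in _ -> _ <= X]eq_bigr do rewrite xE yE.
have [c Hc] := lagrange_multipliers strict (index_enum_uniq _) cvx low.
pose v : 'cV[R]_(\sum_i r i + M * n) := \col_j c j.
have {}Hc p : dom p -> phi p0 + (dotv (usubmx v) (p.2 - p0.2)
    - dotv (K^T *m v) (p.1 - p0.1)) <= phi p.
  move=> dp; apply: le_trans (Hc p dp); rewrite lerD2l le_eqVlt; apply/orP; left.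
  apply/eqP; transitivity (dotv v (col_mx p.2 0 - K *m p.1)); last first.
    by rewrite dotvE; apply: eq_bigr => j _; rewrite [v _ _]mxE.
  rewrite -[col_mx p.2 0 - _]subr0 -Kp0 dotv_mulmx trmxK mulmxBr.
  have -> : dotv (usubmx v) (p.2 - p0.2) = dotv v (col_mx p.2 0 - col_mx p0.2 0).
    rewrite opp_col_mx add_col_mx subrr -{2}[v]vsubmxK dotv_col_mx dotv0.
    by rewrite addr0.
  by rewrite -dotvBr; congr dotv; rewrite !opprD !opprK !addrA; congr (_ + _);
    rewrite addrAC.
have p0f i : xblk p0.1 i = xs by rewrite /p0 /= stackK.
have p0g i : yblk p0.2 i = C i *m xs by rewrite /p0 /= yblk_blkdiag stackK.
exists p0.1, v; split; last split.
- move=> i; have [d1 _] := xdom i; rewrite p0f.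
  exists (fine (f i xs)); first exact: edom_fine.
  move=> x; have [dx|] := boolP (f i x < +oo)%E; last first.
    by rewrite -leNgt leye_eq => /eqP ->; rewrite leey.
  rewrite (edom_fine (f_pcc i) dx) lee_fin.
  pose p : X := (stack (fun j => if j == i then x else xs), p0.2).
  have dp : dom p.
    move=> j; rewrite /= stackK p0g; have [h1 h2] := xdom j; split=> //.
    by case: eqP => [->|].
  have dE : dotv (K^T *m v) (p.1 - p0.1) = dotv (xblk (K^T *m v) i) (x - xs).
    rewrite dotv_xblk (bigD1 i) //= [X in _ + X]big1 => [|j ji].
      by rewrite addr0 xblkD xblkN p0f stackK eqxx.
    by rewrite xblkD xblkN p0f stackK (negPf ji) subrr dotv0.
  have pE : phi p = phi p0 + (fine (f i x) - fine (f i xs)).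
    rewrite /phi [LHS](bigD1 i) //= [X in _ = X + _](bigD1 i) //= !stackK eqxx.
    rewrite [X in _ + X = _](_ : _ = \sum_(j < N | j != i)
      (fine (f j (xblk p0.1 j)) + fine (g j (yblk p0.2 j)))); first by ring.
    by apply: eq_bigr => j ji; rewrite /= !stackK (negPf ji).
  have := Hc p dp; rewrite dE pE /= subrr dotv0 sub0r xblkN dotvNl; lra.
- move=> i; have [_ d2] := xdom i.
  rewrite mul_col_mx col_mxKu yblk_blkdiag p0f.
  exists (fine (g i (C i *m xs))); first exact: edom_fine.
  move=> s; have [ds|] := boolP (g i s < +oo)%E; last first.
    by rewrite -leNgt leye_eq => /eqP ->; rewrite leey.
  rewrite (edom_fine (g_pcc i) ds) lee_fin.
  (* Only block [i] is changed to [s]; block sizes depend on the index, hence the transport along j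
     = i. *)
  pose y j : 'cV[R]_(r j) := if j =P i is ReflectT ji then
    eq_rect_r (fun k => 'cV[R]_(r k)) s ji else C j *m xs.
  have yi : y i = s.
    by rewrite /y; case: eqP => // ii; rewrite (eq_irrelevance ii erefl).
  have yj j : j != i -> y j = C j *m xs by rewrite /y; case: eqP.
  pose p : X := (p0.1, ystack y).
  have dp : dom p.
    move=> j; rewrite /= ystackK p0f; have [h1 h2] := xdom j; split=> //.
    by have [->|ji] := eqVneq j i; [rewrite yi|rewrite yj].
  have dE : dotv (usubmx v) (p.2 - p0.2) = dotv (yblk (usubmx v) i) (s - C i *m xs).
    rewrite dotv_yblk (bigD1 i) //= [X in _ + X]big1 => [|j ji].
      by rewrite addr0 yblkD yblkN p0g ystackK yi.
    by rewrite yblkD yblkN p0g ystackK yj // subrr dotv0.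
  have pE : phi p = phi p0 + (fine (g i s) - fine (g i (C i *m xs))).
    rewrite /phi [LHS](bigD1 i) //= [X in _ = X + _](bigD1 i) //= ystackK yi !p0g.
    rewrite [X in _ + X = _](_ : _ = \sum_(j < N | j != i)
      (fine (f j (xblk p0.1 j)) + fine (g j (yblk p0.2 j)))); first by ring.
    by apply: eq_bigr => j ji; rewrite /= ystackK yj // p0g.
  have := Hc p dp; rewrite dE pE /= subrr dotv0 subr0; lra.
- by rewrite mul_col_mx col_mxKd consensus_const.
Unshelve. all: by end_near. Qed.

End Saddle.

(** * The stepsize condition in matrix form *)

Section Stepsizes.
Context {R : realType} {N M n : nat}.
Variables (ends : 'I_M -> 'I_N * 'I_N) (r : 'I_N -> nat).
Variable C : forall i : 'I_N, 'M[R]_(r i, n).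
Variables (sigma tau : 'I_N -> R) (pi_ : 'I_M -> R).
Hypothesis sigma_gt0 : forall i, 0 < sigma i.

Let K := col_mx (blkdiag C) (consensus_mx n ends).
Let sigmabar := \big[Num.max/0]_(i < N) sigma i.
Let taubar := Num.max (\big[Num.max/0]_(i < N) tau i) (\big[Num.max/0]_(l < M) pi_ l).

Definition xweight (j : 'I_(N * n)) : R := sigma (mxtens_unindex j).1.

Definition yweight (s : 'I_(\sum_i r i + M * n)) : R :=
  match fintype.split s with
  | inl a => tau (tagnat.sig1 a)
  | inr b => pi_ (mxtens_unindex b).1
  end.

Lemma yweight_le s : yweight s <= taubar.
Proof.
rewrite /yweight le_max; case: fintype.split => a; apply/orP; [left|right].
  exact: (le_bigmax _ tau).
exact: (le_bigmax _ pi_).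
Qed.

(** A vertex is required because the maximum over an empty family is its default value 0. *)
Lemma sigmabar_gt0 : (0 < N)%N -> 0 < sigmabar.
Proof.
move=> N0; apply: lt_le_trans (sigma_gt0 (Ordinal N0)) _.
exact: (le_bigmax _ sigma).
Qed.

(** This is hypothesis [step] of the abstract splitting: T is at most taubar, S^-1 at least 1 /
    sigmabar, and |K v|^2 = <v, L v>. *)
Lemma stepsize_quad (c : R) (v : 'cV[R]_(N * n)) : 0 <= c -> (0 < N)%N ->
  (sigmabar^-1 - taubar * c * opnorm (Lmx ends C)) * dotv v v
  + c * wdot yweight (K *m v) (K *m v) <= wdot (fun j => (xweight j)^-1) v v.
Proof.
move=> c0 N0; have s0 := sigmabar_gt0 N0.
have t0 : 0 <= taubar.
  rewrite le_max; apply/orP; left; exact: bigmax_ge_id.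
have h1 : wdot yweight (K *m v) (K *m v) <= taubar * dotv (K *m v) (K *m v).
  rewrite wdotE dotvE mulr_sumr; apply: ler_sum => s _.
  rewrite -mulrA; apply: ler_wpM2r; last exact: yweight_le.
  by rewrite -expr2 sqr_ge0.
have h2 : dotv (K *m v) (K *m v) <= opnorm (Lmx ends C) * dotv v v.
  by rewrite dotv_mulmx mulmxA -Lmx_gram; exact: opnorm_quad.
have h3 : sigmabar^-1 * dotv v v <= wdot (fun j => (xweight j)^-1) v v.
  rewrite wdotE dotvE mulr_sumr; apply: ler_sum => j _.
  rewrite -mulrA; apply: ler_wpM2r; first by rewrite -expr2 sqr_ge0.
  by rewrite /xweight lef_pV2 ?posrE ?sigma_gt0 //; exact: (le_bigmax _ sigma).
have h4 : taubar * dotv (K *m v) (K *m v) <= taubar * (opnorm (Lmx ends C) * dotv v v).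
  exact: ler_wpM2l.
have := ler_wpM2l c0 (le_trans h1 h4); lra.
Qed.

Lemma xblk_wscV (v : 'cV[R]_(N * n)) i :
  xblk (wsc (fun j => (xweight j)^-1) v) i = (sigma i)^-1 *: xblk v i.
Proof. by apply/matrixP => a b; rewrite !mxE /xweight mxtens_indexK. Qed.

(** The function [h] lets one statement serve for T, with the identity, and for T^-1, with the
    inverse. *)
Lemma usubmx_wsc (h : R -> R) (v : 'cV[R]_(\sum_i r i + M * n)) i :
  yblk (usubmx (wsc (fun s => h (yweight s)) v)) i = h (tau i) *: yblk (usubmx v) i.
Proof.
apply/matrixP => a b; rewrite (ord1 b) !mxE /yweight.
by rewrite -[lshift _ _]/(unsplit (inl _)) unsplitK tagnat.Rank1K.
Qed.

Lemma dsubmx_wsc (h : R -> R) (v : 'cV[R]_(\sum_i r i + M * n)) :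
  dsubmx (wsc (fun s => h (yweight s)) v) =
  wsc (fun s => h (pi_ (mxtens_unindex s).1)) (dsubmx v).
Proof.
apply/matrixP => a b; rewrite (ord1 b) !mxE /yweight.
by rewrite -[rshift _ _]/(unsplit (inr _)) unsplitK.
Qed.

End Stepsizes.

(** * The distributed iteration as an instance of the splitting *)

Theorem theorem1 (R : realType) (N M n : nat)
  (e : rel 'I_N) (ends : 'I_M -> 'I_N * 'I_N)
  (e_irrefl : irreflexive e) (e_sym : symmetric e)
  (e_conn : connected_graph e) (e_index : edge_indexing e ends)
  (r : 'I_N -> nat) (C : forall i : 'I_N, 'M[R]_(r i, n))
  (f : 'I_N -> 'cV[R]_n -> \bar R)
  (g : forall i : 'I_N, 'cV[R]_(r i) -> \bar R)
  (f_pcc : forall i : 'I_N, pcc_fun (f i))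
  (g_pcc : forall i : 'I_N, pcc_fun (g i)) :
  let A := consensus_mx n ends in
  let Sstar := minimizers (fun x : 'cV[R]_n =>
    (\sum_(i < N) (f i x + g i (C i *m x)%R))%E) in
  forall (Sstar_nonempty : Sstar !=set0)
  (qualification : exists z : 'I_N -> 'cV[R]_n,
    (forall i : 'I_N, relint (edom (f i)) (z i)
                      /\ relint (edom (g i)) (C i *m z i))
    /\ \sum_(i < N) block_col A i *m z i = 0)
  (theta : R) (sigma tau : 'I_N -> R)
  (kappa : 'I_N -> 'I_N -> R) (pi_ : 'I_M -> R)
  (theta_ge0 : 0 <= theta)
  (sigma_gt0 : forall i : 'I_N, 0 < sigma i)
  (tau_gt0 : forall i : 'I_N, 0 < tau i)
  (pi_gt0 : forall l : 'I_M, 0 < pi_ l)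
  (kappa_pi : forall l : 'I_M,
    kappa (ends l).1 (ends l).2 = pi_ l /\ kappa (ends l).2 (ends l).1 = pi_ l),
  let sigmabar := \big[Num.max/0]_(i < N) sigma i in
  let taubar := Num.max (\big[Num.max/0]_(i < N) tau i)
                        (\big[Num.max/0]_(l < M) pi_ l) in
  let L := Lmx ends C in
  forall (stepsize : if theta == 2
     then 0 <= sigmabar^-1 - taubar * opnorm L
     else 0 < sigmabar^-1 - taubar * (theta ^+ 2 - 3 * theta + 3) * opnorm L)
  (x u rho : nat -> 'I_N -> 'cV[R]_n)
  (y ybar : nat -> forall i : 'I_N, 'cV[R]_(r i))
  (rho_init : exists w0 : 'cV[R]_(M * n),
    forall i : 'I_N, rho 0%N i = (block_col A i)^T *m w0)
  (x_step : forall (k : nat) (i : 'I_N),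
    x k.+1 i \in prox (sigma i) (f i)
      (x k i - sigma i *: rho k i - sigma i *: ((C i)^T *m y k i)))
  (ybar_step : forall (k : nat) (i : 'I_N),
    ybar k i \in prox (tau i) (conjugate (g i))
      (y k i + tau i *: (C i *m (theta *: x k.+1 i + (1 - theta) *: x k i))))
  (y_step : forall (k : nat) (i : 'I_N),
    y k.+1 i = ybar k i
               + (tau i * (2 - theta)) *: (C i *m (x k.+1 i - x k i)))
  (u_step : forall (k : nat) (i : 'I_N), u k i = 2 *: x k.+1 i - x k i)
  (rho_step : forall (k : nat) (i : 'I_N),
    rho k.+1 i = rho k i + \sum_(j < N | e i j) kappa i j *: (u k i - u k j)),
  exists2 xstar : 'cV[R]_n, Sstar xstar &
    stack (x k) @[k --> \oo] --> stack (fun _ : 'I_N => xstar).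
Proof.
move=> A Sstar [xs0 xs0min] [z [zri Az]] theta sigma tau kappa pi_ theta_ge0
  sigma_gt0 tau_gt0 pi_gt0 kappa_pi sigmabar taubar L stepsize x u rho y ybar
  [w0 rho0] x_step ybar_step y_step u_step rho_step.
have [N0 conn] := e_conn.
rewrite sum_block_col in Az.
pose K := col_mx (blkdiag C) A.
have [us [vs sad]] := saddle_exists conn e_index f_pcc g_pcc N0 xs0min zri Az.
pose pw (s : 'I_(M * n)) := pi_ (mxtens_unindex s).1.
(* The edge variables: starting from [w0], they keep rho^k = A^T w^k. *)
pose w := fix w k := if k is k'.+1 then w k' + wsc pw (A *m stack (u k')) else w0.
have rhoE k i : rho k i = xblk (A^T *m w k) i.
  elim: k => [|k IH]; first by rewrite rho0 block_colT.
  rewrite rho_step IH /= mulmxDr xblkD; congr (_ + _).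
  by rewrite (laplacian_step e_irrefl e_sym e_index _ _ kappa_pi).
pose X k := stack (x k).
pose xm k := theta *: X k.+1 + (1 - theta) *: X k.
pose Y k : 'cV[R]_(\sum_i r i + M * n) := col_mx (ystack (y k)) (w k).
(* On the edges h is the indicator of {0}; its conjugate is 0 and has the identity as prox, so the
   intermediate edge variable is the bare gradient step. *)
pose Yb k : 'cV[R]_(\sum_i r i + M * n) :=
  col_mx (ystack (ybar k)) (w k + wsc pw (A *m xm k)).
pose c := theta ^+ 2 - 3 * theta + 3.
(* Indeed 4 c = (2 theta - 3)^2 + 3. *)
have c0 : 0 <= c by have := sqr_ge0 (2 * theta - 3); rewrite /c; lra.
pose eta := sigmabar^-1 - taubar * c * opnorm L.
have eta_ge0 : 0 <= eta.
  move: stepsize; case: eqP => [t2|_ /ltW //].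
  by rewrite /eta (_ : c = 1) ?mulr1 // /c t2; ring.
have eta_gt0 : theta != 2 -> 0 < eta by move=> t2; move: stepsize; rewrite (negPf t2).
have tw_gt0 s : 0 < yweight (n := n) (r := r) tau pi_ s.
  by rewrite /yweight; case: fintype.split.
have xmE k i : xblk (xm k) i = theta *: x k.+1 i + (1 - theta) *: x k i.
  by rewrite xblkD !xblkZ !stackK.
have x_incl k : subdiff_f f (X k.+1)
    (wsc (fun j => (xweight sigma j)^-1) (X k - X k.+1) - K^T *m Y k).
  move=> i; rewrite stackK.
  have [fp _ fc] := f_pcc i.
  have := prox_subgrad (sigma_gt0 i) fp fc (set_mem (x_step k i)).
  congr subgrad; rewrite tr_col_mx mul_row_col !(xblkD, xblkN) xblk_wscV.
  rewrite !(xblkD, xblkN) !stackK xblk_blkdiagT ystackK -rhoE.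
  move: (_ *m y k i) => Cy; apply/matrixP => a b; rewrite !mxE.
  by field; rewrite gt_eqF.
have y_incl k : subdiff_g g (wsc (fun s => (yweight tau pi_ s)^-1) (Y k - Yb k)
    + K *m xm k) (Yb k).
  split=> [i|].
    (* The saddle point supplies the subgradient of g_i that Moreau's decomposition asks for. *)
    have [_ [/(_ i) sg _]] := sad.
    have := prox_conjugate_subgrad (tau_gt0 i) (g_pcc i) sg (set_mem (ybar_step k i)).
    rewrite col_mxKu ystackK.
    rewrite (linearD (@usubmx _ _ _ _)) /= yblkD (usubmx_wsc _ _ (fun a => a^-1)).
    rewrite (linearB (@usubmx _ _ _ _)) /= yblkD yblkN.
    rewrite !col_mxKu !ystackK mul_col_mx col_mxKu yblk_blkdiag xmE.
    congr (subgrad (g i) _ _).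
    move: (_ *m _) => v; apply/matrixP => a b; rewrite !mxE.
    by field; rewrite gt_eqF.
  rewrite (linearD (@dsubmx _ _ _ _)) /= (dsubmx_wsc _ _ (fun a => a^-1)).
  rewrite (linearB (@dsubmx _ _ _ _)) /= !col_mxKd.
  rewrite mul_col_mx col_mxKd; move: (A *m xm k) => v.
  apply/matrixP => a b; rewrite (ord1 b) !mxE /pw.
  by field; rewrite gt_eqF.
have y_upd k : Y k.+1 = Yb k + (2 - theta) *: wsc (yweight tau pi_) (K *m (X k.+1 - X k)).
  rewrite -wscZ scalemxAr -[RHS]vsubmxK; congr col_mx.
    rewrite -[RHS]yblkK -[LHS]yblkK; congr ystack; apply: functional_extensionality_dep => i.
    rewrite (linearD (@usubmx _ _ _ _)) /= yblkD (usubmx_wsc _ _ id) !col_mxKu.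
    rewrite mul_col_mx col_mxKu yblk_blkdiag xblkZ xblkD xblkN !stackK !ystackK y_step.
    by rewrite -scalemxAr scalerA.
  rewrite (linearD (@dsubmx _ _ _ _)) /= (dsubmx_wsc _ _ id).
  rewrite !col_mxKd mul_col_mx col_mxKd.
  rewrite -addrA -/pw; congr (_ + _); rewrite -wscD; congr wsc.
  (* The extrapolated point plus (2 - theta)(x^{k+1} - x^k) is 2 x^{k+1} - x^k = u^k, whatever theta
     is. *)
  rewrite -mulmxDr; congr (_ *m _).
  rewrite /xm /X -[LHS]xblkK -[RHS]xblkK; congr stack; apply/funext => i.
  rewrite !(xblkD, xblkN, xblkZ) !stackK u_step.
  by apply/matrixP => a b; rewrite !mxE; ring.
have [|xl [yl [sad' Xl]]] := primal_dual_cvg (fun j => sigma_gt0 _) tw_gt0 eta_ge0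
  eta_gt0 (fun v => stepsize_quad ends C tau pi_ sigma_gt0 v c0 N0)
  (@subdiff_f_mono _ _ _ f) (@subdiff_g_mono _ _ _ _ _ g)
  (@subdiff_f_closed _ _ _ f f_pcc) (@subdiff_g_closed _ _ _ _ _ g g_pcc)
  x_incl y_incl y_upd.
  by exists us, vs.
have [xs xmin xlE] := saddle_minimizer conn e_index N0 sad'.
by exists xs => //; rewrite -xlE.
Qed.
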